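(* Let $G$ be a finite simple quasi 5-connected graph. If $d_G(x)+d_G(y)\ge 9$ for every pair $x,y$ of vertices of $G$ at distance one or two, then $G$ contains a quasi 5-contractible edge.
   Context: All graphs are finite, simple and undirected; $d_G(x)$ is the degree of $x$, and the distance between two vertices is the length of a shortest path between them. For an edge $e=xy$, $G/e$ denotes the graph obtained by deleting $e$, identifying $x$ and $y$, and replacing any resulting multiple edges by single edges. A cut of a connected graph $G$ is a set $T\subseteq V(G)$ with $G-T$ disconnected; a $k$-cut is a cut with $k$ vertices. A $k$-cut $T$ is nontrivial if the components of $G-T$ can be partitioned into two subgraphs $G_1,G_2$ with $|V(G_1)|\ge 2$ and $|V(G_2)|\ge 2$. A graph is quasi $k$-connected if it is $(k-1)$-connected and has no nontrivial $(k-1)$-cut. An edge $e$ of a quasi $k$-connected graph $G$ is quasi $k$-contractible if $G/e$ is quasi $k$-connected. *)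

(* Defs.v *)
From mathcomp Require Import all_boot.

Set Implicit Arguments.
Unset Strict Implicit.
Unset Printing Implicit Defensive.

Record sgraph := SGraph {
  vertex :> finType;
  adj : rel vertex;
  adj_sym : symmetric adj;
  adj_irr : irreflexive adj }.

Definition degree (G : sgraph) (x : G) : nat := #|[set y | adj x y]|.

(* [p] lists the vertices of the path after [x], so [size p] is the number of
   edges. *)
Definition is_path (G : sgraph) (x y : G) (p : seq G) : Prop :=
  [/\ path (@adj G) x p, uniq (x :: p) & last x p = y].

Definition at_distance (G : sgraph) (x y : G) (n : nat) : Prop :=
  (exists2 p, is_path x y p & size p = n) /\
  (forall p, is_path x y p -> n <= size p).

(* The edge relation of G - S, kept on the vertex type of G: the vertices of S
   are isolated, and those of G - S are the elements of [~: S]. *)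
Definition del_adj (G : sgraph) (S : {set G}) : rel G :=
  fun x y => [&& x \notin S, y \notin S & adj x y].

(* The graph without vertices is not disconnected, so [~: S] has to be
   nonempty. *)
Definition is_cut (G : sgraph) (S : {set G}) : bool :=
  [exists x in ~: S, exists y in ~: S, ~~ connect (del_adj S) x y].

Definition components (G : sgraph) (S : {set G}) : {set {set G}} :=
  equivalence_partition (connect (del_adj S)) (~: S).

(* [C1] and [C2] are the sets of components forming the two subgraphs, whose
   vertex sets are [cover C1] and [cover C2]. *)
Definition nontrivial_cut (G : sgraph) (S : {set G}) : bool :=
  is_cut S &&
  [exists C1 : {set {set G}}, exists C2 : {set {set G}},
    [&& C1 :|: C2 == components S, [disjoint C1 & C2],
        2 <= #|cover C1| & 2 <= #|cover C2|]].

(* The usual convention: a k-connected graph has more than k vertices, so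
   that the complete graph on k + 1 vertices is k-connected but not
   (k + 1)-connected. For k > 0, the case of an empty [S] says that G is
   connected. *)
Definition k_connected (k : nat) (G : sgraph) : Prop :=
  k < #|G| /\ forall S : {set G}, #|S| < k -> ~~ is_cut S.

Definition quasi_connected (k : nat) (G : sgraph) : Prop :=
  k_connected k.-1 G /\
  forall S : {set G}, #|S| = k.-1 -> ~~ nontrivial_cut S.

Section Contraction.
Variables (G : sgraph) (x y : G).

(* The vertices of G/xy: [None] is the vertex obtained by identifying x and
   y, and [Some z] is a vertex z of G other than x and y. *)
Definition contract_vertex : finType := option {z : G | z \notin [set x; y]}.

Definition contract_adj : rel contract_vertex := fun u v =>
  match u, v with
  | Some a, Some b => adj (val a) (val b)
  | Some a, None => adj (val a) x || adj (val a) y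
  | None, Some b => adj x (val b) || adj y (val b)
  | None, None => false
  end.

Lemma contract_adj_sym : symmetric contract_adj.
Proof.
by move=> [a|] [b|] //=; rewrite ?[adj x _]adj_sym ?[adj y _]adj_sym // adj_sym.
Qed.

Lemma contract_adj_irr : irreflexive contract_adj.
Proof. by move=> [a|] //=; rewrite adj_irr. Qed.

Definition contract : sgraph := SGraph contract_adj_sym contract_adj_irr.

End Contraction.

Definition quasi_contractible (k : nat) (G : sgraph) (x y : G) : Prop :=
  adj x y /\ quasi_connected k (contract x y).

(* Main.v *)
(* Suppose that no edge is quasi 5-contractible. Then every edge xy without common
   neighbour of degree 4 lies in a 5-cut that has at least two vertices on both
   sides, and two vertices of degree 4 have distance at least 3. Two crossing
   5-cuts have four corners; opposite corners have boundaries of total size 10,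
   and the boundary of a nonempty corner has at least 4 vertices, at least 5 unless
   the corner is a single vertex of degree 4.

   If all degrees are at least 5, let F be a smallest side of such a cut. Crossing
   F with cuts through edges from F to its boundary gives |F| = 2, say F = {u, v}
   with boundary T. A cut that contains u, v and t in T splits the other vertices
   of T in two pairs. If two such cuts, through r and s, cross, then r lies in a
   two-element side {r, a} with a in T not adjacent to s. If v is adjacent to all of
   T, this makes the degree of s at most 4. Otherwise u misses some r and v some s,
   and a cut through the edge au has a side that is too small.

   If u has degree 4, every edge at u lies in a cut, and a corner without neighbours
   of u has a large boundary. So the position of the four neighbours of u relative
   to the cuts through them leaves one configuration: b and p form a side of a cut
   through u and a neighbour a of u, and another cut through u, b and a third
   neighbour separates a from the fourth one. Crossing the latter with a cut through
   a suitable edge at p is impossible. *)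

Require Import Defs.
From mathcomp Require Import all_boot.
From mathcomp Require Import zify.

Set Implicit Arguments.
Unset Strict Implicit.
Unset Printing Implicit Defensive.

(** * Cuts as labellings and crossing cuts *)

(** The distance condition comes from 4 + 4 < 9. Contracting an edge whose ends have a common
    neighbour of degree 4 gives that neighbour degree 3, so such an edge yields no cut; whenever an
    edge is used, its common neighbours have to be checked. The exception in the corner bound is of
    the same kind: a corner reduced to one vertex of degree 4. It is ruled out by a vertex of the
    boundary which that vertex misses. This explains the two regimes: either no vertex has degree 4,
    or one such vertex [u] lies in the cuts, and any other one is too far away to see [u] or a
    neighbour of [u]. Set against the total 10 for opposite corners, this empties corners or makes
    them single vertices. Two crossing labellings give nine cells, and once the bounds are stated
    every count is a linear problem in the nine cell sizes. *)

Section Labellings.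
Variable G : sgraph.
Implicit Types (f g : G -> option bool) (C D K E : {set G}).

(* A labelling [f] describes a vertex cut, the vertices labelled [None], and the
   two sides [Some true] and [Some false]. *)
Definition part f (s : option bool) : {set G} := [set z | f z == s].
Definition flip f : G -> option bool := fun z => omap negb (f z).

Definition separates f :=
  forall x y (b : bool), adj x y -> f x = Some b -> f y <> Some (~~ b).

Definition cut5 f :=
  [/\ separates f, #|part f None| = 5 & forall b : bool, 2 <= #|part f (Some b)|].

(** [D] only has to contain the neighbours of [C] outside [C]: it may be larger and may meet [C].
    Lower bounds on [#|D|] can therefore be applied to any convenient superset of the true
    boundary. *)
Definition bounds D C :=
  forall x y, x \in C -> adj x y -> y \in C :|: D.

Definition cell f g (s t : option bool) : {set G} := [set z | (f z == s) && (g z == t)].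
Definition ncell f g (s t : option bool) := #|cell f g s t|.

(** The boundary of the corner labelled [Some b] by [f] and [Some c] by [g]. The sizes of two
    opposite walls add up to the sizes of the two cuts, because the cell of vertices in both cuts
    belongs to every wall; this is the origin of the total 10. *)
Definition wall f g (b c : bool) : {set G} :=
  [set z | [|| (f z == Some b) && (g z == None), (f z == None) && (g z == None)
             | (f z == None) && (g z == Some c)]].

Lemma adjC (x y : G) : adj x y = adj y x.
Proof. exact: adj_sym. Qed.

Lemma adjxx (x : G) : adj x x = false.
Proof. exact: adj_irr. Qed.

Lemma adj_neq (x y : G) : adj x y -> x != y.
Proof. by apply: contraTneq => ->; rewrite adjxx. Qed.

Lemma part_flip f b : part (flip f) (Some b) = part f (Some (~~ b)).
Proof. by apply/setP => z; rewrite !inE /flip; case: (f z) => [[]|]; case: b. Qed.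

Lemma part_flipN f : part (flip f) None = part f None.
Proof. by apply/setP => z; rewrite !inE /flip; case: (f z). Qed.

Lemma separates_flip f : separates f -> separates (flip f).
Proof.
move=> sf x y b xy; rewrite /flip; move: (sf x y (~~ b) xy).
by case: (f x) => [[]|] //=; case: (f y) => [[]|] //=; case: b => //= H _ _; apply: H.
Qed.

Lemma cut5_flip f : cut5 f -> cut5 (flip f).
Proof.
case=> sf f5 f2; split; [exact: separates_flip | by rewrite part_flipN |].
by move=> b; rewrite part_flip.
Qed.

Lemma ncell_row f g (s : option bool) :
  #|part f s| = ncell f g s None + ncell f g s (Some true) + ncell f g s (Some false).
Proof.
rewrite /ncell -!sum1_card /part.
rewrite (bigID (fun z => g z == None)) /=; rewrite -addnA; congr (_ + _).
  by apply: eq_bigl => z; rewrite !inE.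
rewrite (bigID (fun z => g z == Some true)) /=; congr (_ + _);
  by apply: eq_bigl => z; rewrite !inE; case: (g z) => [[]|] /=; rewrite ?andbT ?andbF.
Qed.

Lemma ncellC f g (s t : option bool) : ncell f g s t = ncell g f t s.
Proof. by apply: eq_card => z; rewrite !inE andbC. Qed.

Lemma ncell_col f g (t : option bool) :
  #|part g t| = ncell f g None t + ncell f g (Some true) t + ncell f g (Some false) t.
Proof. by rewrite (ncell_row g f) !(ncellC f g). Qed.

Lemma ncell_gt0 f g (s t : option bool) z : f z = s -> g z = t -> 0 < ncell f g s t.
Proof. by move=> fz gz; apply/card_gt0P; exists z; rewrite inE fz gz !eqxx. Qed.

Lemma ncell_gt1 f g (s t : option bool) y z :
  f y = s -> g y = t -> f z = s -> g z = t -> y != z -> 1 < ncell f g s t.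
Proof.
move=> fy gy fz gz yz; have <- : #|[set y; z]| = 2 by rewrite cards2 yz.
by apply/subset_leq_card/subsetP => w /set2P[] ->; rewrite inE ?fy ?gy ?fz ?gz !eqxx.
Qed.

Lemma ncell_gt2 f g (s t : option bool) x y z :
  f x = s -> g x = t -> f y = s -> g y = t -> f z = s -> g z = t ->
  x != y -> x != z -> y != z -> 2 < ncell f g s t.
Proof.
move=> fx gx fy gy fz gz xy xz yz.
have <- : #|[set x; y; z]| = 3.
  by rewrite [_ :|: _]setUC cardsU1 cards2 !inE ![z == _]eq_sym negb_or xz yz xy.
apply/subset_leq_card/subsetP => w; rewrite !inE -orbA.
by case/or3P=> /eqP ->; rewrite ?fx ?gx ?fy ?gy ?fz ?gz !eqxx.
Qed.

Lemma ncell_eq0 f g (s t : option bool) z : ncell f g s t = 0 -> f z = s -> g z <> t.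
Proof. by move=> n0 fz gz; have := ncell_gt0 fz gz; rewrite n0. Qed.

Lemma card_wall f g (b c : bool) :
  #|wall f g b c| = ncell f g (Some b) None + ncell f g None None + ncell f g None (Some c).
Proof.
rewrite /ncell -!sum1_card.
rewrite (bigID (fun z => f z == Some b)) /= -addnA; congr (_ + _).
  apply: eq_bigl => z; rewrite !inE.
  by case: (f z == Some b) / eqP => [->|] //=; rewrite ?andbF //= orbF andbT.
rewrite (bigID (fun z => g z == None)) /=; congr (_ + _);
  apply: eq_bigl => z; rewrite !inE;
  by case: (f z) => [[]|]; case: (g z) => [[]|]; case: (b); case: (c).
Qed.

Lemma bounds_cell f g (b c : bool) : separates f -> separates g ->
  bounds (wall f g b c) (cell f g (Some b) (Some c)).
Proof.
move=> sf sg x y; rewrite inE => /andP[/eqP fx /eqP gx] xy; rewrite !inE.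
move: (sf x y b xy fx) (sg x y c xy gx).
by case: (f y) => [[]|] //=; case: (g y) => [[]|] //=; case: (b); case: (c).
Qed.

End Labellings.

(* What remains of the hypotheses of the theorem in a graph without quasi
   5-contractible edge. *)
Record critical (G : sgraph) : Prop := Critical {
  conn4 : forall C D : {set G}, bounds D C -> 0 < #|C| -> 0 < #|~: (C :|: D)| ->
    4 <= #|D|;
  conn5 : forall C D : {set G}, bounds D C -> 2 <= #|C| -> 2 <= #|~: (C :|: D)| ->
    5 <= #|D|;
  deg_ge4 : forall v : G, 4 <= degree v;
  far : forall v w : G, v != w -> degree v <= 4 -> degree w <= 4 ->
    ~~ adj v w /\ (forall z, adj v z -> ~~ adj w z);
  edge_cut : forall x y : G, adj x y ->
    (forall z, adj x z -> adj y z -> 5 <= degree z) ->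
    exists f, [/\ cut5 f, f x = None & f y = None] }.

Section Quasi5.
Variable G : sgraph.
Implicit Types (f g : G -> option bool) (C D K E : {set G}).
Hypothesis cG : critical G.

Lemma bounds5 C D x : bounds D C -> x \in C -> 2 <= #|~: (C :|: D)| ->
  (forall v, C = [set v] -> degree v <= 4 -> exists2 d, d \in D & ~~ adj v d) ->
  5 <= #|D|.
Proof.
move=> bD xC rest H; have [C2|C2] := leqP 2 #|C|; first exact: (conn5 cG bD C2 rest).
have C1 : #|C| == 1 by rewrite eqn_leq -ltnS C2; apply/card_gt0P; exists x.
have {C1} [v Cv] := cards1P C1.
have ND : [set y | adj v y] \subset D.
  apply/subsetP => y; rewrite inE => vy.
  have : y \in C :|: D by apply: bD vy; rewrite Cv set11.
  by rewrite Cv !inE => /orP[/eqP yv|//]; move: vy; rewrite yv adjxx.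
have dD : degree v <= #|D| by exact: subset_leq_card.
have [dv|dv] := leqP (degree v) 4; last exact: leq_trans dv dD.
have [d dD' nd] := H v Cv dv.
have D4 : 4 <= #|D|.
  apply: (conn4 cG bD); first by rewrite Cv cards1.
  exact: leq_trans rest.
have [D5|D5] := leqP 5 #|D|; first by [].
have : #|D :\ d| >= 4.
  apply: leq_trans (subset_leq_card (_ : [set y | adj v y] \subset _)); last first.
    apply/subsetP => y yN; rewrite !inE (subsetP ND _ yN) andbT.
    by apply: contraNneq nd => <-; move: yN; rewrite inE.
  have sC : bounds [set y | adj v y] C.
    by move=> a b; rewrite Cv !inE => /eqP -> ->; rewrite orbT.
  apply: (conn4 cG sC); first by rewrite Cv cards1.
  apply: leq_trans (subset_leq_card (_ : ~: (C :|: D) \subset _)).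
    exact: leq_trans rest.
  by rewrite setCS; apply: setUS.
by rewrite cardsDS ?sub1set // cards1; lia.
Qed.

(** Otherwise [t] could be left out of the boundary of that side, and four vertices would separate
    two sets of at least two vertices. *)
Lemma cut_nbr f t (b : bool) : cut5 f -> f t = None -> exists2 z, f z = Some b & adj t z.
Proof.
case=> sf f5 f2 ft.
case: (pickP [pred z | (f z == Some b) && adj t z]) => [z /andP[/eqP]|nz]; first by exists z.
suff : 5 <= #|part f None :\ t| by rewrite cardsDS ?sub1set ?inE ?ft // cards1 f5.
apply: (@conn5 _ cG (part f (Some b))) => //; last first.
  apply: leq_trans (f2 (~~ b)) (subset_leq_card _); apply/subsetP => z.
  by rewrite !inE => /eqP ->; case: (b); rewrite /= andbF.
move=> x y; rewrite !inE => /eqP fx xy.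
have := sf x y b xy fx; have := nz x; rewrite inE fx eqxx /= => /negbT tx.
have : y != t by apply: contraNneq tx => <-; rewrite adjC.
by move=> ->; case: (f y) => [[]|] //; case: (b).
Qed.

(* [K] collects vertices of the wall without neighbours in the corner and [E]
   vertices of the corner that are moved to its boundary. *)
Section Corner.
Variables (f g : G -> option bool) (b c : bool) (K E : {set G}).
Hypotheses (cf : cut5 f) (sg : separates g).
Hypotheses (sK : K \subset wall f g b c) (sE : E \subset cell f g (Some b) (Some c)).
Hypothesis nK : forall k z, k \in K -> f z = Some b -> g z = Some c ->
  z \notin E -> ~~ adj k z.

Let C := cell f g (Some b) (Some c) :\: E.
Let D := (wall f g b c :\: K) :|: E.

Lemma corner_bounds : bounds D C.
Proof.
have [sf _ _] := cf.
move=> x y xC xy; have := xC; rewrite inE => /andP[xE xc].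
have := bounds_cell sf sg xc xy; rewrite !(in_setU, in_setD).
have [yE|yE] := boolP (y \in E) => /=; first by rewrite orbT.
have [yK|yK] := boolP (y \in K) => /=; last by rewrite orbF.
move: xc; rewrite inE => /andP[/eqP fx /eqP gx].
by have := nK yK fx gx xE; rewrite adjC xy.
Qed.

Lemma corner_card : #|D| + #|K| = #|wall f g b c| + #|E|.
Proof.
rewrite cardsU cardsDS // (_ : _ :&: E = set0) ?cards0; last first.
  apply/setP => z; rewrite !inE; apply/negP => /andP[/andP[_ zw] /(subsetP sE)].
  rewrite inE => /andP[/eqP fz /eqP gz]; move: zw; rewrite fz gz /=; by rewrite !andbF.
by have := subset_leq_card sK; lia.
Qed.

(** The side of [f] opposite to the corner meets neither the corner nor its wall. *)
Lemma corner_rest : 2 <= #|~: (C :|: D)|.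
Proof.
have [_ _ f2] := cf; apply: leq_trans (f2 (~~ b)) (subset_leq_card _).
apply/subsetP => z zb; move: (zb); rewrite !inE => /eqP fz.
have zE : z \notin E.
  apply: contraL zb => /(subsetP sE); rewrite !inE => /andP[/eqP -> _].
  by case: (b).
by rewrite (negbTE zE) fz; case: (b); rewrite /= ?andbF.
Qed.

Lemma corner4 : #|E| < ncell f g (Some b) (Some c) -> 4 + #|K| <= #|wall f g b c| + #|E|.
Proof.
move=> lt; rewrite -corner_card leq_add2r; apply: (conn4 cG corner_bounds).
  by rewrite cardsDS // subn_gt0.
exact: leq_trans corner_rest.
Qed.

Lemma corner5 : #|E| < ncell f g (Some b) (Some c) ->
  (forall v, C = [set v] -> degree v <= 4 -> exists2 d, d \in D & ~~ adj v d) ->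
  5 + #|K| <= #|wall f g b c| + #|E|.
Proof.
move=> lt H; rewrite -corner_card leq_add2r.
have /card_gt0P[x xC] : 0 < #|C| by rewrite cardsDS // subn_gt0.
exact: bounds5 corner_bounds xC corner_rest H.
Qed.

End Corner.

Lemma cell1_nbrs f g (b c : bool) v : separates f -> separates g ->
  cell f g (Some b) (Some c) = [set v] -> #|wall f g b c| <= degree v ->
  forall z, adj v z = (z \in wall f g b c).
Proof.
move=> sf sg cv wd z; have bw := bounds_cell (b := b) (c := c) sf sg.
suff /eqP/setP/(_ z) : [set y | adj v y] == wall f g b c by rewrite inE.
rewrite eqEcard wd andbT; apply/subsetP => y; rewrite inE => vy.
have : y \in cell f g (Some b) (Some c) :|: wall f g b c.
  by apply: bw vy; rewrite cv set11.
by rewrite cv !(inE, in_setU) => /orP[/eqP yv|//]; move: vy; rewrite yv adjxx.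
Qed.

Lemma corner_nil5 f g (b c : bool) : cut5 f -> separates g -> 2 <= ncell f g (Some b) (Some c) ->
  5 <= #|wall f g b c|.
Proof.
move=> cf sg n2; have := @corner5 f g b c set0 set0 cf sg (sub0set _) (sub0set _).
rewrite !cards0 !addn0; apply.
- by move=> k z; rewrite inE.
- exact: leq_trans n2.
- by move=> v; rewrite setD0 => cv; move: n2; rewrite /ncell cv cards1.
Qed.

Lemma corner_nil4 f g (b c : bool) : cut5 f -> separates g -> 1 <= ncell f g (Some b) (Some c) ->
  4 <= #|wall f g b c|.
Proof.
move=> cf sg n2; have := @corner4 f g b c set0 set0 cf sg (sub0set _) (sub0set _).
by rewrite !cards0 !addn0; apply=> //; move=> k z; rewrite inE.
Qed.

(** * Sides with two vertices *)

Section Pair.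
Variables (f g : G -> option bool) (p q : G).
Hypotheses (cf : cut5 f) (fpq : part f (Some true) = [set p; q]) (pq : p != q).
Hypotheses (cg : cut5 g) (gp : g p = None).

Lemma pair_side z : (f z == Some true) = (z == p) || (z == q).
Proof. by have /setP/(_ z) := fpq; rewrite !inE. Qed.

Lemma pair_nbr (s : bool) : g q <> Some s ->
  exists2 z, adj p z & f z = None /\ g z = Some s.
Proof.
move=> gq; have [z gz pz] := cut_nbr s cg gp; exists z => //; split=> //.
have fp : f p = Some true by apply/eqP; rewrite pair_side eqxx.
have [sf _ _] := cf; have := sf p z true pz fp; have := pair_side z.
case: (f z) => [[]|] //= /esym/orP[]/eqP zE; first by rewrite zE gp in gz.
by case: gq; rewrite -zE.
Qed.

(** A cut through [p] that avoids [q] exhibits a vertex of the cut [f] seen by [p] but not by [q],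
    namely a neighbour of [p] on the side away from [q]. Whenever [q] misses no suitable vertex,
    this forces [q] into the cut. *)
Lemma pair_nonnbr (s : bool) : g q = Some s ->
  exists z, [/\ f z = None, adj p z, ~~ adj q z & g z = Some (~~ s)].
Proof.
move=> gq; have [|z pz [fz gz]] := @pair_nbr (~~ s); first by rewrite gq; case: s {gq}.
exists z; split=> //; apply/negP => qz.
by have [sg _ _] := cg; apply: (sg q z s qz gq).
Qed.

(** If only one vertex [t] of the cut [f] lies on side [s] of [g], the corner of that side away from
    the pair has a wall of (5 - 2) + 1 = 4 vertices. So this corner is a single vertex [v] of degree
    4 whose neighbourhood is the wall. If no side has just one such vertex, only the split 1, 2, 2
    remains. *)
Lemma pair_cut y : g q = None -> f y = None -> g y = None ->
  [/\ ncell f g None None = 1, ncell f g None (Some true) = 2 & ncell f g None (Some false) = 2]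
  \/ exists (s : bool) v t, [/\ part g (Some s) = [set t; v], t != v, f t = None, degree v <= 4 &
       forall z, adj v z = (z == t) || [&& g z == None, z != p & z != q]].
Proof.
move=> gq fy gy; have [sf f5 f2] := cf; have [sg g5 g2] := cg.
have fp : f p = Some true by apply/eqP; rewrite pair_side eqxx.
have fq : f q = Some true by apply/eqP; rewrite pair_side eqxx orbT.
have n2 := ncell_gt1 fp gp fq gq pq; have n1 := ncell_gt0 fy gy.
have c2 : #|part f (Some true)| = 2 by rewrite fpq cards2 pq.
have side (s : bool) : 0 < ncell f g None (Some s).
  by have [|z _ [fz gz]] := @pair_nbr s; [rewrite gq | exact: ncell_gt0 fz gz].
have r1 := ncell_row f g (Some true); have r0 := ncell_row f g None.
have k0 := ncell_col f g None.
have [[s ns]|[nt nf]] : (exists s : bool, ncell f g None (Some s) = 1) \/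
    (ncell f g None (Some true) <> 1 /\ ncell f g None (Some false) <> 1).
  case: (ncell f g None (Some true) =P 1) => H1; first by left; exists true.
  by case: (ncell f g None (Some false) =P 1) => H2; [left; exists false | right].
2: by left; have := side true; have := side false => *; split; lia.
right; exists s; have ks := ncell_col f g (Some s); have := g2 s.
have w4 := card_wall f g false s; have w5 := @corner_nil5 f g false s cf sg.
have nt : ncell f g (Some true) (Some s) = 0 by case: (s); lia.
have m1 : ncell f g (Some false) (Some s) = 1 by have := g2 s; lia.
have [v cv] : exists v, cell f g (Some false) (Some s) = [set v].
  by apply/cards1P; rewrite -/(ncell _ _ _ _) m1.
have [t ct] : exists t, cell f g None (Some s) = [set t].
  by apply/cards1P; rewrite -/(ncell _ _ _ _) ns.
have := set11 v; rewrite -cv inE => /andP[/eqP fv /eqP gv].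
have := set11 t; rewrite -ct inE => /andP[/eqP ft /eqP gt].
have wc : #|wall f g false s| = 4 by have := corner_nil4 cf sg (eq_leq (esym m1)); lia.
have adjv := cell1_nbrs sf sg cv (eq_leq (etrans wc _)).
have {}adjv : forall z, adj v z = (z \in wall f g false s).
  by apply: cell1_nbrs sf sg cv _; rewrite wc; exact: deg_ge4 cG v.
exists v, t; split=> //.
- apply/setP => z; have /setP/(_ z) := cv; have /setP/(_ z) := ct; rewrite !inE => <- <-.
  have := @ncell_eq0 _ f g (Some true) (Some s) z nt.
  case: (f z) => [[]|] //=; last by rewrite orbF.
  by move=> /(_ erefl) /eqP/negbTE ->.
- by apply: contra_eqN fv => /eqP <-; rewrite ft.
- by rewrite /degree -wc; apply/subset_leq_card/subsetP => z; rewrite inE adjv.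
move=> z; rewrite adjv inE; have /setP/(_ z) := ct; rewrite !inE => <-.
rewrite -negb_or -pair_side.
by case: (f z) => [[]|]; case: (g z) => [[]|]; case: (s).
Qed.

End Pair.

End Quasi5.

(** * Minimum degree 5: the smallest side has two vertices *)

Section MinDegree5.
Variable G : sgraph.
Implicit Types (f g : G -> option bool) (C D K E : {set G}).
Hypothesis cG : critical G.
Hypothesis deg5 : forall v : G, 5 <= degree v.

Lemma edge_cut_deg5 (x y : G) : adj x y -> exists f, [/\ cut5 f, f x = None & f y = None].
Proof. by move=> xy; apply: (edge_cut cG xy) => z _ _; apply: deg5. Qed.

Lemma corner_nil f g (b c : bool) : cut5 f -> separates g ->
  0 < ncell f g (Some b) (Some c) -> 5 <= #|wall f g b c|.
Proof.
move=> cf sg n0; have := @corner5 _ cG f g b c set0 set0 cf sg (sub0set _) (sub0set _).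
rewrite !cards0 !addn0; apply=> //.
- by move=> k z; rewrite inE.
- by move=> v _; rewrite leqNgt deg5.
Qed.

(** Such a corner is itself a side of a 5-cut, formed by its wall: this is the competitor against
    which a smallest side is tested. *)
Lemma corner_cut5 f g (b c : bool) : cut5 f -> cut5 g ->
  2 <= ncell f g (Some b) (Some c) -> #|wall f g b c| = 5 ->
  exists2 h, cut5 h & part h (Some true) = cell f g (Some b) (Some c).
Proof.
move=> [sf _ f2] [sg _ _] n2 w5; set C := cell _ _ _ _; set W := wall _ _ _ _ in w5.
pose h z := if z \in C then Some true else if z \in W then None else Some false.
have pC : part h (Some true) = C.
  by apply/setP => z; rewrite inE /h; case: (z \in C); case: (z \in W).
exists h => //; split.
- have bC x y : adj x y -> h x = Some true -> h y <> Some false.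
    move=> xy; rewrite /h; case xC: (x \in C); last by case: ifP.
    have := bounds_cell sf sg xC xy; rewrite in_setU -/C -/W.
    by case: (y \in C); case: (y \in W).
  by move=> x y [] xy hx hy; [apply: (bC x y xy hx hy) | apply: (bC y x _ hy hx); rewrite adjC].
- rewrite -w5; apply: eq_card => z; rewrite [in LHS]inE /h.
  case zC: (z \in C); last by case: (z \in W).
  move: zC; rewrite !inE => /andP[/eqP -> /eqP ->]; by rewrite !andbF.
- case; first by rewrite pC.
  apply: leq_trans (f2 (~~ b)) (subset_leq_card _); apply/subsetP => z.
  by rewrite !inE /h !inE => /eqP ->; case: (b).
Qed.

Lemma corner1 f g (b c : bool) : cut5 f -> separates g ->
  ncell f g (Some b) (Some c) = 1 -> #|wall f g b c| = 5 ->
  exists w, [/\ cell f g (Some b) (Some c) = [set w], f w = Some b, g w = Some c,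
    degree w = 5 & forall z, adj w z = (z \in wall f g b c)].
Proof.
move=> [sf _ _] sg n1 w5; have [w cw] : exists w, cell f g (Some b) (Some c) = [set w].
  by apply/cards1P; rewrite -/(ncell _ _ _ _) n1.
have := set11 w; rewrite -cw inE => /andP[/eqP fw /eqP gw].
have aw : forall z, adj w z = (z \in wall f g b c).
  by apply: cell1_nbrs sf sg cw _; rewrite w5.
by exists w; split=> //; rewrite /degree -w5; apply: eq_card => z; rewrite inE aw.
Qed.

Section Minimal.
Variables (n : nat) (f : G -> option bool).
Hypotheses (cf : cut5 f) (fn : #|part f (Some true)| = n).
Hypothesis minf : forall g, cut5 g -> n <= #|part g (Some true)|.

Lemma minf_side g (b : bool) : cut5 g -> n <= #|part g (Some b)|.
Proof.
by case: b => cg; [exact: minf | have := minf (cut5_flip cg); rewrite part_flip].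
Qed.

(** A corner inside the smallest side is smaller than that side, since [x] is not in it. With two or
    more vertices it would need a wall of at least 6, leaving at most 4 for the opposite wall and
    hence no vertex in the opposite corner; the minimal size of the other sides then gives a
    contradiction. So both corners inside the side have at most one vertex, and the listed counts
    are all that is left. *)
Lemma minf_cross g x y : cut5 g -> f x = Some true -> f y = None ->
  g x = None -> g y = None ->
  [\/ n = 2,
      [/\ n = 4, ncell f g (Some true) None = 2, ncell f g None None = 1 &
          forall s : bool, ncell f g (Some true) (Some s) = 1 /\ ncell f g None (Some s) = 2],
      [/\ n = 3, ncell f g (Some true) None = 1, ncell f g None None = 3 &
          forall s : bool, ncell f g (Some true) (Some s) = 1 /\ ncell f g None (Some s) = 1] |
      [/\ n = 3, ncell f g (Some true) None = 2, ncell f g None None = 1,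
          forall s : bool, ncell f g None (Some s) = 2 &
          exists s : bool, ncell f g (Some true) (Some s) = 1]].
Proof.
move=> cg fx fy gx gy; have [sf f5 _] := cf; have [sg g5 _] := cg.
have n1 := ncell_gt0 fx gx; have n2 := ncell_gt0 fy gy.
have big (s : bool) : 2 <= ncell f g (Some true) (Some s) ->
    n <= ncell f g (Some true) (Some s) \/ 6 <= #|wall f g true s|.
  move=> k2; have := corner_nil cf sg (ltnW k2); rewrite leq_eqVlt.
  case/orP=> [/eqP w5|]; last by right.
  have [h ch hc] := corner_cut5 cf cg k2 (esym w5).
  by left; have := minf ch; rewrite hc.
have c1 := @corner_nil f g true true cf sg; have c2 := @corner_nil f g true false cf sg.
have c3 := @corner_nil f g false true cf sg; have c4 := @corner_nil f g false false cf sg.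
have b1 := big true; have b2 := big false.
have m1 := minf_side true cf; have m2 := minf_side false cf.
have m3 := minf_side true cg; have m4 := minf_side false cg.
move: c1 c2 c3 c4 b1 b2 m1 m2 m3 m4; rewrite !card_wall.
have r0 := ncell_row f g None; have r1 := ncell_row f g (Some true).
have r2 := ncell_row f g (Some false); have k0 := ncell_col f g None.
have k1 := ncell_col f g (Some true); have k2 := ncell_col f g (Some false).
move: r0 r1 r2 k0 k1 k2; rewrite f5 g5 fn => r0 r1 r2 k0 k1 k2.
rewrite r2 k1 k2 => c1 c2 c3 c4 b1 b2 _ m2 m3 m4; clear big.
have t1 : ncell f g (Some true) (Some true) <= 1 by lia.
have t2 : ncell f g (Some true) (Some false) <= 1 by lia.
case: (leqP n 2) => n3.
  by constructor 1; have [_ _ /(_ true)] := cf; rewrite fn; lia.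
case: (posnP (ncell f g (Some true) (Some true))) => p1;
  case: (posnP (ncell f g (Some true) (Some false))) => p2.
- by exfalso; lia.
- constructor 4; split; [by lia.. | by case; lia | exists false; lia].
- constructor 4; split; [by lia.. | by case; lia | exists true; lia].
- have [n34|n34] : n = 3 \/ n = 4 by lia.
    by constructor 3; split; [lia.. | case; lia].
  by constructor 2; split; [lia.. | case; lia].
Qed.

Lemma part_cells g (s : option bool) z : (f z == s) =
  [|| z \in cell f g s None, z \in cell f g s (Some true) | z \in cell f g s (Some false)].
Proof. by rewrite !inE; case: (f z == s); case: (g z) => [[]|]. Qed.

(** [w] and [w'] are the two corners inside the side. Their neighbourhoods are the corresponding
    walls, which together contain the whole cut [f]. *)
Lemma min4 x y : n = 4 -> f x = Some true -> f y = None -> adj x y ->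
  exists x' w w', [/\ forall z, (f z == Some true) = [|| z == x, z == x', z == w | z == w'],
    [/\ adj w x, adj w x', adj w y & degree w = 5],
    [/\ adj w' x, adj w' x', adj w' y & degree w' = 5], ~~ adj w w' &
    forall t, f t = None -> adj w t || adj w' t].
Proof.
move=> n4 fx fy xy; have [g [cg gx gy]] := edge_cut_deg5 xy; have [sg _ _] := cg.
case: (minf_cross cg fx fy gx gy) => [|[_ a2 c1 cells]|[]|[]]; try by rewrite n4.
have [[t1 t2] [u1 u2]] := (cells true, cells false).
have w1 : #|wall f g true true| = 5 by rewrite card_wall a2 c1 t2.
have w2 : #|wall f g true false| = 5 by rewrite card_wall a2 c1 u2.
have [w [cw fw gw dw aw]] := corner1 cf sg t1 w1.
have [w' [cw' fw' gw' dw' aw']] := corner1 cf sg u1 w2.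
have /cards2P[x1 [x2 [x12 cx]]] : #|cell f g (Some true) None| == 2 by apply/eqP.
have [x' cx'] : exists x', cell f g (Some true) None = [set x; x'].
  have : x \in [set x1; x2] by rewrite -cx inE fx gx !eqxx.
  by rewrite cx !inE => /orP[]/eqP ->; [exists x2 | exists x1; rewrite setUC].
have : x' \in cell f g (Some true) None by rewrite cx' !inE eqxx orbT.
rewrite inE => /andP[/eqP fx' /eqP gx'].
exists x', w, w'; split.
- by move=> z; rewrite (part_cells g) cx' cw cw' !inE -!orbA.
- by split=> //; rewrite aw inE ?fx ?gx ?fx' ?gx' ?fy ?gy.
- by split=> //; rewrite aw' inE ?fx ?gx ?fx' ?gx' ?fy ?gy.
- by rewrite aw inE fw' gw'.
by move=> t ft; rewrite aw aw' !inE ft; case: (g t) => [[]|].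
Qed.

(** The two outcomes correspond to the cut through [s] and [t] meeting the side in [s] alone, with a
    single vertex in each corner, or in two vertices, with one corner empty. In each case a corner
    vertex has its wall as neighbourhood; [p] is a vertex of the cut [f] on the side of [w]. *)
Lemma min3 s t : n = 3 -> f s = Some true -> f t = None -> adj s t ->
  (exists w w' p, [/\ forall z, (f z == Some true) = [|| z == s, z == w | z == w'],
    [/\ adj w s, adj w' s & ~~ adj w w'], adj w t, adj w' t &
    [/\ f p = None, adj w p & ~~ adj w' p]]) \/
  (exists s' w, [/\ forall z, (f z == Some true) = [|| z == s, z == s' | z == w],
    adj w s, adj w s', adj w t & degree w = 5]).
Proof.
move=> n3 fs ft st; have [g [cg gs gt]] := edge_cut_deg5 st; have [sg _ _] := cg.
case: (minf_cross cg fs ft gs gt) => [|[]|[_ a1 c3 cells]|[_ a2 c1 cells [b tb]]]; try by rewrite n3.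
  left; have [[t1 t2] [u1 u2]] := (cells true, cells false).
  have w1 : #|wall f g true true| = 5 by rewrite card_wall a1 c3 t2.
  have w2 : #|wall f g true false| = 5 by rewrite card_wall a1 c3 u2.
  have [w [cw fw gw dw aw]] := corner1 cf sg t1 w1.
  have [w' [cw' fw' gw' dw' aw']] := corner1 cf sg u1 w2.
  have /cards1P[s1 cs] : #|cell f g (Some true) None| == 1 by apply/eqP.
  have : s \in [set s1] by rewrite -cs inE fs gs !eqxx.
  rewrite inE => /eqP s1E; rewrite -s1E in cs.
  have /card_gt0P[p] : 0 < ncell f g None (Some true) by rewrite t2.
  rewrite inE => /andP[/eqP fp /eqP gp].
  exists w, w', p; split.
  - by move=> z; rewrite (part_cells g) cs cw cw' !inE.
  - by rewrite !aw !aw' !inE fs gs fw' gw'.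
  - by rewrite aw inE ft gt.
  - by rewrite aw' inE ft gt.
  by rewrite aw aw' !inE fp gp.
right; have w5 : #|wall f g true b| = 5 by rewrite card_wall a2 c1 cells.
have [w [cw fw gw dw aw]] := corner1 cf sg tb w5.
have z0 : ncell f g (Some true) (Some (~~ b)) = 0.
  by have := ncell_row f g (Some true); rewrite fn n3; case: (b) tb => /= tb; lia.
have /cards2P[x1 [x2 [x12 cx]]] : #|cell f g (Some true) None| == 2 by apply/eqP.
have [s' cs] : exists s', cell f g (Some true) None = [set s; s'].
  have : s \in [set x1; x2] by rewrite -cx inE fs gs !eqxx.
  by rewrite cx !inE => /orP[]/eqP ->; [exists x2 | exists x1; rewrite setUC].
have : s' \in cell f g (Some true) None by rewrite cs !inE eqxx orbT.
rewrite inE => /andP[/eqP fs' /eqP gs'].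
exists s', w; split=> //; first last.
- by rewrite aw inE ft gt.
- by rewrite aw inE fs' gs'.
- by rewrite aw inE fs gs.
move=> z; have c0 : cell f g (Some true) (Some (~~ b)) = set0 by apply/cards0_eq.
by rewrite (part_cells g) cs; case: (b) cw c0 => /= -> ->; rewrite !inE ?orbF -?orbA.
Qed.

Lemma min_edge y : f y = None -> exists2 x, f x = Some true & adj x y.
Proof. by move=> fy; have [z fz yz] := cut_nbr cG true cf fy; exists z; rewrite // adjC. Qed.

(** Applied to an edge from [w] to the cut, [min4] yields two vertices of the side adjacent to [w].
    They can only be [x] and [x'], so both have degree 5 and see the other end of that edge; the
    same holds for [w']. As [w] and [w'] together see the whole cut, [x] sees all of it and [w]
    besides: six neighbours. *)
Lemma not_min4 : n <> 4.
Proof.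
move=> n4; have [_ f5 _] := cf.
have /card_gt0P[y] : 0 < #|part f None| by rewrite f5.
rewrite inE => /eqP fy; have [x fx xy] := min_edge fy.
have [x' [w [w' [F [wx wx' wy dw] [w'x w'x' w'y dw'] ww' cov]]]] := min4 n4 fx fy xy.
have fw : f w = Some true by apply/eqP; rewrite F eqxx !orbT.
have fw' : f w' = Some true by apply/eqP; rewrite F eqxx !orbT.
have aux v v' t : f v = Some true -> adj v t -> f t = None -> ~~ adj v v' ->
    (forall z, (f z == Some true) = [|| z == x, z == x', z == v | z == v']) ->
    adj x t /\ degree x = 5.
  move=> fv vt ft vv' F'.
  have [v1 [u [u' [F2 [uv _ ut du] [u'v _ u't du'] uu' _]]]] := min4 n4 fv ft vt.
  have uIn z : adj z v -> f z = Some true -> z = x \/ z = x'.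
    move=> zv /eqP; rewrite F' => /or4P[]/eqP zE; [by left | by right | |].
      by rewrite zE adjxx in zv.
    by rewrite zE adjC (negbTE vv') in zv.
  have fu : f u = Some true by apply/eqP; rewrite F2 eqxx !orbT.
  have fu' : f u' = Some true by apply/eqP; rewrite F2 eqxx !orbT.
  have uu : u <> u'.
    move=> E; have : #|part f (Some true)| <= 3.
      apply: leq_trans (_ : #|[set v; v1; u]| <= 3).
        by apply/subset_leq_card/subsetP => z; rewrite !inE F2 E -!orbA orbb.
      by rewrite cardsU cards1 cards2; apply: leq_trans (leq_subr _ _) _; case: (_ != _).
    by rewrite fn n4.
  have := uIn _ uv fu; have := uIn _ u'v fu'.
  move=> [E'|E'] [E|E]; try by rewrite E E' in uu.
    by rewrite -E' u't du'.
  by rewrite -E ut du.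
have F' z : (f z == Some true) = [|| z == x, z == x', z == w' | z == w].
  by rewrite F [(z == w) || _]orbC.
have xT t : f t = None -> adj x t.
  move=> ft; case/orP: (cov t ft) => wt; first by case: (aux w w' t).
  by case: (aux w' w t) => //; rewrite adjC.
have [_ dx] := aux w w' y fw wy fy ww' F.
have : #|w |: part f None| <= degree x.
  apply/subset_leq_card/subsetP => z; rewrite !inE => /orP[/eqP ->|/eqP/xT //].
  by rewrite adjC.
by rewrite dx cardsU1 f5 inE fw.
Qed.

(** The side is a triangle of vertices of degree 5, so each of them sees at most three of the five
    cut vertices. Those missed by [w], at least two, are seen by both [s] and [s'], and each cut
    vertex is seen by [s] or [s']: this would need 5 + 2 <= 3 + 3. *)
Lemma not_min3 : n <> 3.
Proof.
move=> n3; have [sf f5 _] := cf.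
(* The outcome of [min3] with non-adjacent [w] and [w'] is impossible: applying [min3] to the edge
   [w p], and then to [s p], makes [w'] adjacent to [w] or to [p]. *)
have all2 s t : f s = Some true -> f t = None -> adj s t ->
    exists s' w, [/\ forall z, (f z == Some true) = [|| z == s, z == s' | z == w],
      adj w s, adj w s', adj w t & degree w = 5].
  move=> fs ft st; case: (min3 n3 fs ft st) => //.
  move=> [w [w' [p [F [ws w's ww'] wt w't [fp wp w'p]]]]]; exfalso.
  have fw : f w = Some true by apply/eqP; rewrite F eqxx !orbT.
  have fw' : f w' = Some true by apply/eqP; rewrite F eqxx !orbT.
  have w'w : w' != w by apply: contraTneq wp => <-.
  case: (min3 n3 fw fp wp) => [[u [u' [_ [F2 [uw u'w _] _ _ _]]]]|[s2 [v [F2 vw vs2 vp _]]]].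
    have := F2 w'; rewrite fw' eqxx (negbTE w'w) /= => /esym/orP[]/eqP E.
      by move: ww'; rewrite adjC E uw.
    by move: ww'; rewrite adjC E u'w.
  have vs : v = s.
    have /esym := F v; rewrite F2 eqxx !orbT => /or3P[]/eqP // vE.
      by rewrite vE adjxx in vw.
    by move: ww'; rewrite adjC -vE vw.
  rewrite {}vs in vw vs2 vp F2.
  case: (min3 n3 fs fp vp) => [[u [u' [_ [F3 _ up u'p _]]]]|[s3 [v' [F3 _ v's3 _ _]]]].
    have := F3 w'; rewrite fw' eqxx (negbTE (adj_neq w's)) /= => /esym/orP[]/eqP E.
      by rewrite E up in w'p.
    by rewrite E u'p in w'p.
  have := F3 w'; rewrite fw' eqxx (negbTE (adj_neq w's)) /= => /esym w'3.
  have := F3 w; rewrite fw eqxx (negbTE (adj_neq ws)) /= => /esym w3.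
  case/orP: w'3 => /eqP E; case/orP: w3 => /eqP E'.
  - by rewrite E E' eqxx in w'w.
  - by rewrite E E' v's3 in ww'.
  - by rewrite E E' adjC v's3 in ww'.
  - by rewrite E E' eqxx in w'w.
have /card_gt0P[y] : 0 < #|part f None| by rewrite f5.
rewrite inE => /eqP fy; have [s fs sy] := min_edge fy.
have [s' [w [F ws ws' wy dw]]] := all2 s y fs fy sy.
have fw : f w = Some true by apply/eqP; rewrite F eqxx !orbT.
have fs' : f s' = Some true by apply/eqP; rewrite F eqxx !orbT.
have ss' : s != s'.
  apply/eqP => E; have : #|part f (Some true)| <= 2.
    apply: leq_trans (_ : #|[set s; w]| <= 2); last by rewrite cards2; case: (_ != _).
    by apply/subset_leq_card/subsetP => z; rewrite !inE F -E orbA orbb.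
  by rewrite fn n3.
pose A v := [set t | (f t == None) && adj v t].
have A3 v a b : degree v = 5 -> f a = Some true -> f b = Some true -> a != b ->
    adj v a -> adj v b -> #|A v| <= 3.
  move=> dv fa fb ab va vb; have : #|A v :|: [set a; b]| <= degree v.
    apply/subset_leq_card/subsetP => z; rewrite !inE => /or3P[/andP[]|/eqP->|/eqP->] //.
  rewrite dv cardsU cards2 ab (_ : A v :&: _ = set0) ?cards0; first by rewrite subn0 => H; rewrite -(leq_add2r 2).
  by apply/setP => z; rewrite !inE; apply/negP => /andP[/andP[/eqP fz _] /orP[]/eqP E];
    rewrite E ?fa ?fb in fz.
have two v t : f v = Some true -> f t = None -> adj v t ->
    exists2 v', f v' = Some true & [/\ adj v' v, adj v' t & degree v' = 5].
  move=> fv ft vt; have [v1 [v' [F' ? _ ? ?]]] := all2 v t fv ft vt.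
  by exists v' => //; apply/eqP; rewrite F' eqxx !orbT.
have both q : f q = None -> ~~ adj w q -> adj s q /\ adj s' q.
  move=> fq wq; have [v fv vq] := min_edge fq; have [v' fv' [v'v v'q _]] := two v q fv fq vq.
  have inF u : f u = Some true -> adj u q -> u = s \/ u = s'.
    move=> /eqP; rewrite F => /or3P[]/eqP ->; [by left | by right | by rewrite (negbTE wq)].
  case: (inF v fv vq) => E; case: (inF v' fv' v'q) => E';
    by move: vq v'q v'v; rewrite E E' ?adjxx // => -> ->.
have Aw := A3 w s s' dw fs fs' ss' ws ws'.
have /card_gt0P[q] : 0 < #|part f None :\: A w|.
  rewrite cardsDS ?f5 ?subn_gt0 //; first by apply: leq_trans Aw _.
  by apply/subsetP => z; rewrite !inE => /andP[].
rewrite !inE => /andP[+ /eqP fq]; rewrite fq /= => wq.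
have [sq s'q] := both q fq wq.
have As' : #|A s'| <= 3.
  have [v fv [vs vq dv]] := two s q fs fq sq.
  have /esym := F v; rewrite fv eqxx (negbTE (adj_neq vs)) /= => /orP[]/eqP vE.
    rewrite vE in vs dv; apply: (A3 s' s w) => //; last by rewrite adjC.
    by rewrite eq_sym adj_neq.
  by rewrite -vE vq in wq.
have As : #|A s| <= 3.
  have [v fv [vs vq dv]] := two s' q fs' fq s'q.
  have /esym := F v; rewrite fv eqxx (negbTE (adj_neq vs)) /= => /orP[]/eqP vE.
    rewrite vE in vs dv; apply: (A3 s s' w) => //; last by rewrite adjC.
    by rewrite eq_sym adj_neq.
  by rewrite -vE vq in wq.
have cover : part f None \subset A s :|: A s'.
  apply/subsetP => t; rewrite !inE => /eqP ft; rewrite ft /=.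
  have [wt|/(both t ft)[-> //]] := boolP (adj w t).
  have [v fv [vw vt _]] := two w t fw ft wt.
  by have /esym := F v; rewrite fv eqxx (negbTE (adj_neq vw)) orbF /= => /orP[]/eqP <-; rewrite vt ?orbT.
have meet : part f None :\: A w \subset A s :&: A s'.
  apply/subsetP => t; rewrite !inE => /andP[+ /eqP ft]; rewrite ft /= => wt.
  by have [-> ->] := both t ft wt.
have := subset_leq_card cover; have := subset_leq_card meet.
rewrite cardsU f5 cardsDS ?f5; last by apply/subsetP => z; rewrite !inE => /andP[].
move: Aw As As'; move: #|A w| #|A s| #|A s'| #|_ :&: _| => i j k l; clear; lia.
Qed.

Lemma min_side2 : n = 2.
Proof.
have [_ f5 _] := cf; have /card_gt0P[y] : 0 < #|part f None| by rewrite f5.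
rewrite inE => /eqP fy; have [x fx xy] := min_edge fy.
have [g [cg gx gy]] := edge_cut_deg5 xy.
case: (minf_cross cg fx fy gx gy) => [//|[n4]|[n3]|[n3]]; first by case: (not_min4 n4).
all: by case: (not_min3 n3).
Qed.

End Minimal.
End MinDegree5.

(** * Minimum degree 5: sides with two vertices *)

Lemma cards2_other (T : finType) (A : {set T}) x :
  x \in A -> #|A| = 2 -> exists2 y, y != x & A = [set x; y].
Proof.
move=> xA /eqP /cards2P[a [b [ab AE]]]; move: xA; rewrite AE !inE.
by case/orP=> /eqP ->; [exists b; rewrite // eq_sym | exists a; rewrite // setUC].
Qed.

Section PairMinDegree5.
Variable G : sgraph.
Implicit Types (f g : G -> option bool) (C D K E : {set G}).
Hypothesis cG : critical G.
Hypothesis deg5 : forall v : G, 5 <= degree v.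

Lemma pair_cut5 f p q g y : cut5 f -> part f (Some true) = [set p; q] -> p != q ->
  cut5 g -> g p = None -> g q = None -> f y = None -> g y = None ->
  [/\ ncell f g None None = 1, ncell f g None (Some true) = 2 & ncell f g None (Some false) = 2].
Proof.
move=> cf fpq pq cg gp gq fy gy.
case: (pair_cut cG cf fpq pq cg gp gq fy gy) => // -[s [v [t [_ _ _ dv _]]]].
by have := deg5 v; rewrite ltnNge dv.
Qed.

Variables (f : G -> option bool) (u v : G).
Hypotheses (cf : cut5 f) (fuv : part f (Some true) = [set u; v]) (uv : u != v).

(* The neighbours of the pair [u, v] outside it are the vertices [z] with
   [f z = None]; a corner that meets none of them does not see [u] and [v]. *)
Lemma cornerT fs fr (b c : bool) E : cut5 fs -> cut5 fr ->
  fs u = None -> fs v = None -> fr u = None -> fr v = None ->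
  E \subset cell fs fr (Some b) (Some c) ->
  (forall z, fs z = Some b -> fr z = Some c -> f z = None -> z \in E) ->
  #|E| < ncell fs fr (Some b) (Some c) -> 7 <= #|wall fs fr b c| + #|E|.
Proof.
move=> cs [sr _ _] su sv ru rv sE TE lt.
have := @corner5 _ cG fs fr b c [set u; v] E cs sr.
rewrite cards2 uv; apply=> //.
- by apply/subsetP => z; rewrite !inE => /orP[]/eqP ->; rewrite ?su ?ru ?sv ?rv !eqxx ?orbT.
- have [sf _ _] := cf; move=> k z kuv sz rz zE; apply/negP => kz.
  have fk : f k = Some true by apply/eqP; move: kuv; rewrite -fuv inE.
  have := sf k z true kz fk; case fz: (f z) => [[]|] //= _; last first.
    by rewrite (TE z sz rz fz) in zE.
  have /setP/(_ z) := fuv; rewrite !inE fz eqxx => /esym/orP[]/eqP E0.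
    by rewrite E0 su in sz.
  by rewrite E0 sv in sz.
- by move=> w _; rewrite leqNgt deg5.
Qed.

(** This is the case where [fr] does not separate [a] from [s]. The side [{r, a}] of [fs] is crossed
    with a cut [g] through [r] and the vertex [y] of [fs] that [a] misses. Then [g] also contains
    [a] and separates [s] from two vertices [x] and [x'] of [fs]. Both turn out to lie in [fr],
    which leaves too few neighbours for [s]. *)
Lemma cross_same fs fr r s a : cut5 fs -> cut5 fr ->
  fs u = None -> fs v = None -> fs s = None ->
  fr u = None -> fr v = None -> fr r = None -> f r = None -> f s = None ->
  r != s -> fs r = Some true -> fr s = Some true ->
  f a = None -> fs a = Some true -> fr a = Some true ->
  ncell fs fr (Some true) (Some false) = 0 -> ncell fs fr (Some false) (Some true) = 0 ->
  ncell fs fr (Some true) (Some true) = 1 -> ncell fs fr (Some true) None = 1 ->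
  #|wall fs fr true true| = 5 -> ncell fs fr None (Some false) = 1 -> False.
Proof.
move=> cs cr su sv ss ru rv rr fr0 fs0 rs sr rs1 fa sa ra eTF eFT eTT eTN w5 eNF.
have [ssep s5 s2] := cs; have [rsep r5 r2] := cr.
have [sn1 snt snf] := pair_cut5 cf fuv uv cs su sv fs0 ss.
have k1 := ncell_col fs fr (Some true); have w2 := card_wall fs fr true true.
have ar : a != r by apply: contra_eqN ra => /eqP ->; rewrite rr.
have pa : part fs (Some true) = [set r; a].
  have rin : r \in part fs (Some true) by rewrite inE sr.
  have [|a' a'r pE] := cards2_other rin; first by rewrite (ncell_row fs fr) eTF eTT eTN.
  have : a \in part fs (Some true) by rewrite inE sa.
  by rewrite pE !inE (negbTE ar) => /eqP ->.
have [a' [ca' _ _ _ adja]] := corner1 deg5 cs rsep eTT w5.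
have a'E : a' = a.
  by apply/eqP; rewrite eq_sym -in_set1 -ca' inE sa ra !eqxx.
rewrite {}a'E in ca' adja.
have /card_gt0P[y] : 0 < ncell fs fr None (Some false) by rewrite eNF.
rewrite inE => /andP[/eqP sy /eqP ry].
have ay : ~~ adj a y by rewrite adja inE sy ry.
have r_y : adj r y.
  have [z sz yz] := cut_nbr cG true cs sy.
  have : z \in part fs (Some true) by rewrite inE sz.
  rewrite pa !inE => /orP[]/eqP zE; rewrite zE adjC in yz; first by [].
  by rewrite yz in ay.
have [g [cg gr gy]] := edge_cut_deg5 cG deg5 r_y.
have ra_ : r != a by rewrite eq_sym.
(* Otherwise [a] would miss a vertex of [fs] outside [g]; but in [fs] it misses only [y]. *)
have ga : g a = None.
  case ga: (g a) => [b|] //.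
  have [z [sz rz az gz]] := pair_nonnbr cG cs pa cg gr ga.
  have zy : z = y.
    apply/eqP; case rz0: (fr z) => [[]|].
    - by move: az; rewrite adja inE sz rz0.
    - by apply: contraTT isT => zy; have := ncell_gt1 sz rz0 sy ry zy; rewrite eNF.
    - by move: az; rewrite adja inE sz rz0.
  by rewrite zy gy in gz.
have [gn1 gnt gnf] := pair_cut5 cs pa ra_ cg gr ga sy gy.
have ys : y != s by apply: contra_eqN ry => /eqP ->; rewrite rs1.
case gs: (g s) => [b|]; last by have := ncell_gt1 sy gy ss gs ys; rewrite gn1.
have x2 : ncell fs g None (Some (~~ b)) = 2 by case: (b); rewrite /= ?gnt ?gnf.
have /card_gt0P[x xin] : 0 < ncell fs g None (Some (~~ b)) by rewrite x2.
have [x' x'x xE] := cards2_other xin x2.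
have : x' \in cell fs g None (Some (~~ b)) by rewrite xE !inE eqxx orbT.
move: xin; rewrite !inE => /andP[/eqP sx /eqP gx] /andP[/eqP sx' /eqP gx'].
have [gsep _ _] := cg.
have opp z : g z = Some (~~ b) -> ~~ adj s z.
  by move=> gz; apply/negP => sz; case: (gsep s z b sz gs).
(* [s] is the only vertex of the cut [f] in [fs], so a [z] on the side of [s] in [fr] would see
   neither [u] nor [v]. Being separated from [s] by [g] as well, it would have degree at most 4. *)
have inM z : fs z = None -> g z = Some (~~ b) -> fr z = None.
  move=> sz gz; case rz: (fr z) => [[]|] //; last first.
    have zy : z != y by apply: contra_eqN gz => /eqP ->; rewrite gy.
    by have := ncell_gt1 sz rz sy ry zy; rewrite eNF.
  have zs : z != s by apply: contra_eqN gz => /eqP ->; rewrite gs; case: (b).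
  exfalso; have zuv w : w \in [set u; v] -> ~~ adj z w.
    rewrite -fuv inE => /eqP fw; apply/negP; rewrite adjC => wz; have [sf _ _] := cf.
    have := sf w z true wz fw; case fz: (f z) => [[]|] //= _.
      have : z \in [set u; v] by rewrite -fuv inE fz.
      by rewrite !inE => /orP[]/eqP E; rewrite E ?ru ?rv in rz.
    by have := ncell_gt1 fz sz fs0 ss zs; rewrite sn1.
  have : degree z <= #|(part fr (Some true) :|: part fr None) :\: [set z; s; u; v]|.
    apply/subset_leq_card/subsetP => w; rewrite !inE => zw.
    have wz : w != z by rewrite eq_sym adj_neq.
    have ws : w != s by apply: contraTneq zw => ->; rewrite adjC opp.
    have wu : w != u by apply: contraTneq zw => ->; rewrite zuv // !inE eqxx.
    have wv : w != v by apply: contraTneq zw => ->; rewrite zuv // !inE eqxx orbT.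
    rewrite (negbTE wz) (negbTE ws) (negbTE wu) (negbTE wv) /=.
    by have := rsep z w true zw rz; case: (fr w) => [[]|].
  rewrite cardsDS; last first.
    by apply/subsetP => w; rewrite !inE -!orbA => /or4P[]/eqP ->; rewrite ?rz ?rs1 ?ru ?rv.
  rewrite cardsU (_ : part fr _ :&: _ = set0) ?cards0 ?r5; last first.
    by apply/setP => w; rewrite !inE; case: (fr w) => [[]|].
  rewrite (_ : #|[set z; s; u; v]| = 4); last first.
    have tN w : fr w = None -> (z != w) && (s != w).
      by move=> rw; apply/andP; split; apply/eqP => E; rewrite -E ?rz ?rs1 in rw.
    have /andP[zu su'] := tN u ru; have /andP[zv sv'] := tN v rv.
    apply: (@eq_trans _ _ #|[:: z; s; u; v]|).
      by apply: eq_card => w; rewrite !inE -!orbA.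
    have /card_uniqP-> // : uniq [:: z; s; u; v].
    by rewrite /= !inE !negb_or zs zu zv su' sv' uv.
  have := ncell_gt0 su ru; have := ncell_gt1 sz rz ss rs1 zs; have := deg5 z.
  have := ncell_gt1 su ru sv rv uv.
  clear - k1 w2 w5 eTF eFT eTT eTN; move: (degree z); lia.
have rx := inM x sx gx; have rx' := inM x' sx' gx'.
(* If two vertices of [fs] lie on the side of [s] in [fr], then [x] and [x'] must be [u] and [v],
   one of which [s] sees. Otherwise that side is [{s, a}], and [s] has at most 1 + 3 neighbours. *)
have [n_NT|n_NT] := leqP (ncell fs fr None (Some true)) 1; last first.
  have nNN : ncell fs fr None None = 2.
    by have := ncell_gt1 su ru sv rv uv; clear - w2 w5 n_NT eTN; lia.
  have /eqP cE : [set x; x'] == cell fs fr None None.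
    rewrite eqEcard cards2 (eq_sym x) x'x -/(ncell _ _ _ _) nNN andbT.
    by apply/subsetP => w; rewrite !inE => /orP[]/eqP ->; rewrite ?sx ?rx ?sx' ?rx'.
  have [w fw sw] := cut_nbr cG true cf fs0.
  have : w \in [set u; v] by rewrite -fuv inE fw.
  move=> wuv; have : w \in [set x; x'].
    by rewrite cE; move: wuv; rewrite !inE => /orP[]/eqP ->; rewrite ?su ?sv ?ru ?rv.
  by rewrite !inE => /orP[]/eqP E; [have := opp x gx | have := opp x' gx']; rewrite -E sw.
have : degree s <= #|(part fr (Some true) :\ s) :|: (part fr None :\: [set x; x'])|.
  apply/subset_leq_card/subsetP => z; rewrite !inE => sz.
  have zs : z != s by rewrite eq_sym adj_neq.
  have zx : z != x by apply: contraTneq sz => ->; exact: opp.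
  have zx' : z != x' by apply: contraTneq sz => ->; exact: opp.
  rewrite zs (negbTE zx) (negbTE zx') /=.
  by have := rsep s z true sz rs1; case: (fr z) => [[]|].
move=> ds; have := leq_trans (leq_trans (deg5 s) ds) (leq_card_setU _ _).
rewrite !cardsDS ?r5 ?cards2 ?cards1 1?eq_sym ?x'x; first last.
- by rewrite sub1set inE rs1.
- by apply/subsetP => z; rewrite !inE => /orP[]/eqP ->; rewrite ?rx ?rx'.
by clear - k1 n_NT eFT eTT; lia.
Qed.

(** [a] is the other vertex of the cut [f] on the side of [fs] that contains [r]. If [fr] separates
    [a] from [s], they are not adjacent, and the corner bounds reduce the side to [{r, a}]. The case
    where [fr] keeps them together is reduced to [cross_same]. *)
Lemma cross_pair_true fs fr r s : cut5 fs -> cut5 fr ->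
  fs u = None -> fs v = None -> fs s = None ->
  fr u = None -> fr v = None -> fr r = None -> f r = None -> f s = None ->
  r != s -> fs r = Some true -> fr s = Some true ->
  exists a, [/\ part fs (Some true) = [set r; a], f a = None, a != r & ~~ adj a s].
Proof.
move=> cs cr su sv ss ru rv rr fr0 fs0 rs sr rs1.
have [ssep s5 s2] := cs; have [rsep r5 r2] := cr.
have [sn1 snt snf] := pair_cut5 cf fuv uv cs su sv fs0 ss.
have [rn1 rnt rnf] := pair_cut5 cf fuv uv cr ru rv fr0 rr.
have [a ar aE] : exists2 a, a != r & cell f fs None (Some true) = [set r; a].
  by apply: cards2_other; rewrite ?inE ?fr0 ?sr ?eqxx.
have : a \in cell f fs None (Some true) by rewrite aE !inE eqxx orbT.
rewrite inE => /andP[/eqP fa /eqP sa].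
have /card_gt0P[c] : 0 < ncell f fs None (Some false) by rewrite snf.
move=> cin; have [d dc dE] := cards2_other cin snf; move: cin.
have : d \in cell f fs None (Some false) by rewrite dE !inE eqxx orbT.
rewrite !inE => /andP[/eqP fd /eqP sd] /andP[/eqP fc /eqP sc].
have inT z : f z = None -> [|| z == r, z == a, z == c, z == d | z == s].
  move=> fz; case sz: (fs z) => [[]|].
  - by have /setP/(_ z) := aE; rewrite !inE fz sz => /esym/orP[]->; rewrite ?orbT.
  - by have /setP/(_ z) := dE; rewrite !inE fz sz => /esym/orP[]->; rewrite ?orbT.
  - case: (eqVneq z s) => zs; rewrite ?orbT //.
    by have := ncell_gt1 fz sz fs0 ss zs; rewrite sn1.
have rN z : f z = None -> z != r -> fr z <> None.
  by move=> fz zr rz; have := ncell_gt1 fz rz fr0 rr zr; rewrite rn1.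
have neq x y : fs x = Some true -> fs y = Some false -> x != y.
  by move=> sx sy; apply: contra_eqN sx => /eqP ->; rewrite sy.
have neq' x y : fs x = None -> fs y <> None -> x != y.
  by move=> sx sy; apply: contraPneq sy => <-; rewrite sx.
have cr0 : c != r by rewrite eq_sym neq.
have dr0 : d != r by rewrite eq_sym neq.
have two x y z b : f x = None -> f y = None -> f z = None -> fr x = Some b ->
    fr y = Some b -> fr z = Some b -> x != y -> x != z -> y != z -> False.
  move=> fx fy fz rx ry rz xy xz yz; have := ncell_gt2 fx rx fy ry fz rz xy xz yz.
  by case: (b); rewrite ?rnt ?rnf.
have sa' : s != a by apply: neq' => //; rewrite sa.
have sc' : s != c by apply: neq' => //; rewrite sc.
have sd' : s != d by apply: neq' => //; rewrite sd.
have ac : a != c by exact: neq.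
have ad : a != d by exact: neq.
have cd : c != d by rewrite eq_sym.
have r0 := ncell_row fs fr None; have r1 := ncell_row fs fr (Some true).
have r3 := ncell_row fs fr (Some false); have k0 := ncell_col fs fr None.
have k1 := ncell_col fs fr (Some true); have k2 := ncell_col fs fr (Some false).
have uvn := ncell_gt1 su ru sv rv uv.
have n_r := ncell_gt0 sr rr; have n_s := ncell_gt0 ss rs1.
have C5 b e : 0 < ncell fs fr (Some b) (Some e) -> 5 <= #|wall fs fr b e|.
  exact: (corner_nil cG deg5 cs rsep).
(* A corner that avoids the cut [f] sees neither [u] nor [v], whence 5 + 2. A single vertex of the
   cut [f] in the corner can be moved to its boundary at the price of one, whence 6 in [C6]. *)
have C7 b e : (forall z, fs z = Some b -> fr z = Some e -> f z <> None) ->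
    0 < ncell fs fr (Some b) (Some e) -> 7 <= #|wall fs fr b e|.
  move=> H n0; have := @cornerT fs fr b e set0 cs cr su sv ru rv (sub0set _).
  by rewrite cards0 addn0; apply=> // z sz rz fz; case: (H z sz rz fz).
have C6 b e t : fs t = Some b -> fr t = Some e ->
    (forall z, fs z = Some b -> fr z = Some e -> f z = None -> z = t) ->
    1 < ncell fs fr (Some b) (Some e) -> 6 <= #|wall fs fr b e|.
  move=> st rt H n0; have := @cornerT fs fr b e [set t] cs cr su sv ru rv.
  rewrite cards1 addn1; apply=> //; first by rewrite sub1set inE st rt !eqxx.
  by move=> z sz rz fz; rewrite (H z sz rz fz) inE.
have side_a : #|part fs (Some true)| = 2 -> part fs (Some true) = [set r; a].
  move=> c2; have rin : r \in part fs (Some true) by rewrite inE sr.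
  have [a' a'r pE] := cards2_other rin c2.
  have : a \in part fs (Some true) by rewrite inE sa.
  by rewrite pE !inE (negbTE ar) => /eqP ->.
exists a; case ra: (fr a) => [[]|]; last by case: (rN a fa ar).
- exfalso.
  have rcF : fr c = Some false.
    case rc: (fr c) => [[]|] //; last by case: (rN c fc cr0).
    by case: (two s a c true).
  have rdF : fr d = Some false.
    case rd: (fr d) => [[]|] //; last by case: (rN d fd dr0).
    by case: (two s a d true).
  have tf := C7 true false; have ft := C7 false true.
  have {tf} tf : 0 < ncell fs fr (Some true) (Some false) -> 7 <= #|wall fs fr true false|.
    apply: tf => z sz rz fz.
    have := inT z fz; case/or4P=> [/eqP E|/eqP E|/eqP E|/orP[]/eqP E];
      by rewrite E ?rr ?ra ?sc ?sd ?ss in sz rz.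
  have {ft} ft : 0 < ncell fs fr (Some false) (Some true) -> 7 <= #|wall fs fr false true|.
    apply: ft => z sz rz fz.
    have := inT z fz; case/or4P=> [/eqP E|/eqP E|/eqP E|/orP[]/eqP E];
      by rewrite E ?sr ?sa ?rcF ?rdF ?ss in sz rz.
  have tt : 1 < ncell fs fr (Some true) (Some true) -> 6 <= #|wall fs fr true true|.
    apply: (C6 _ _ a) => // z sz rz fz.
    have := inT z fz; case/or4P=> [/eqP E|/eqP E|/eqP E|/orP[]/eqP E] //;
      by rewrite E ?rr ?sc ?sd ?ss in sz rz.
  have f1 := C5 false false (ncell_gt0 sc rcF); have t1 := C5 true true (ncell_gt0 sa ra).
  have na := ncell_gt0 sa ra.
  have := card_wall fs fr true false; have := card_wall fs fr false true.
  have := card_wall fs fr true true; have := card_wall fs fr false false.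
  move=> w1 w2 w3 w4; rewrite s5 in r0; rewrite r5 in k0.
  clear C5 C6 C7.
  have [eTF eFT eTT] : [/\ ncell fs fr (Some true) (Some false) = 0,
     ncell fs fr (Some false) (Some true) = 0 & ncell fs fr (Some true) (Some true) = 1].
    clear - w1 w2 w3 w4 tf ft tt f1 t1 na r0 r1 r3 k0 k1 k2 uvn n_r n_s; split; lia.
  have w5 : #|wall fs fr true true| = 5.
    clear - w1 w2 w3 w4 f1 t1 r0 r1 r3 k0 k1 k2 eTF eFT eTT; lia.
  (* [u] and [v] take two of the five places in this wall, so one of its other two cells has a
     single vertex. Exchanging the two cuts, and with them [r] and [s], exchanges the cases. *)
  have [eTN|eNT] : ncell fs fr (Some true) None = 1 \/ ncell fs fr None (Some true) = 1.
  - clear - w2 w5 n_r n_s uvn; lia.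
  - apply: (@cross_same fs fr r s a) => //; clear - w2 w5 eTN r0; lia.
  - apply: (@cross_same fr fs s r a) => //; rewrite ?card_wall ?(ncellC fr fs) //.
    + by rewrite eq_sym.
    + clear - w2 w5; lia.
    + clear - w2 w5 eNT k0; lia.
have as_ : ~~ adj a s.
  by apply/negP => as_; case: (rsep a s false as_ ra).
(* Each side of [fr] contains two of [a], [s], [c], [d]. As [a] and [s] are separated, so are [c]
   and [d], and both corners on the side of [fs] away from [r] meet the cut [f]. *)
have [b' [d' [fb' sb' rb' [fd' sd'' rd']]]] : exists b' d',
    [/\ f b' = None, fs b' = Some false, fr b' = Some true &
        [/\ f d' = None, fs d' = Some false & fr d' = Some false]].
  case rc: (fr c) => [[]|]; last by case: (rN c fc cr0).
    exists c, d; split=> //; split=> //.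
    case rd: (fr d) => [[]|] //; last by case: (rN d fd dr0).
    by case: (two s c d true).
  exists d, c; split=> //.
  case rd: (fr d) => [[]|] //; last by case: (rN d fd dr0).
  by case: (two a c d false).
have ftlt : forall z, f z = None -> fs z = Some true -> fr z = Some true -> False.
  move=> z fz sz rz; have := inT z fz.
  case/or4P=> [/eqP E|/eqP E|/eqP E|/orP[]/eqP E];
      by rewrite E ?rr ?ra ?sc ?sd ?ss in sz rz.
have tt : 0 < ncell fs fr (Some true) (Some true) -> 7 <= #|wall fs fr true true|.
  by apply: C7 => z sz rz fz; exact: ftlt fz sz rz.
have tf : 1 < ncell fs fr (Some true) (Some false) -> 6 <= #|wall fs fr true false|.
  apply: (C6 _ _ a) => // z sz rz fz.
  have := inT z fz; case/or4P=> [/eqP E|/eqP E|/eqP E|/orP[]/eqP E] //;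
      by rewrite E ?rr ?sc ?sd ?ss in sz rz.
have f1 := C5 false false (ncell_gt0 sd'' rd'); have t1 := C5 true false (ncell_gt0 sa ra).
have g1 := C5 false true (ncell_gt0 sb' rb').
have na := ncell_gt0 sa ra.
have := card_wall fs fr true false; have := card_wall fs fr false true.
have := card_wall fs fr true true; have := card_wall fs fr false false.
move=> w1 w2 w3 w4; rewrite s5 in r0; rewrite r5 in k0.
clear C5 C6 C7.
split=> //; apply: side_a.
clear - w1 w2 w3 w4 tf tt f1 t1 g1 na r0 r1 r3 k0 k1 k2 uvn n_r n_s; lia.
Qed.

Lemma cross_pair fs fr r s : cut5 fs -> cut5 fr ->
  fs u = None -> fs v = None -> fs s = None ->
  fr u = None -> fr v = None -> fr r = None -> f r = None -> f s = None ->
  r != s ->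
  exists a b, [/\ part fs (Some b) = [set r; a], f a = None, a != r & ~~ adj a s].
Proof.
move=> cs cr su sv ss ru rv rr fr0 fs0 rs.
have [sn1 _ _] := pair_cut5 cf fuv uv cs su sv fs0 ss.
have [rn1 _ _] := pair_cut5 cf fuv uv cr ru rv fr0 rr.
case sr: (fs r) => [b|]; last by have := ncell_gt1 fr0 sr fs0 ss rs; rewrite sn1.
case rs1: (fr s) => [c|]; last by have := ncell_gt1 fr0 rr fs0 rs1 rs; rewrite rn1.
pose up (h : G -> option bool) (e : bool) := if e then h else flip h.
have upN h e z : h z = None -> up h e z = None by case: e; rewrite /up /flip => // ->.
have upT h (e : bool) z : h z = Some e -> up h e z = Some true.
  by case: e; rewrite /up /flip => ->.
have upC h e : cut5 h -> cut5 (up h e) by case: e => // ch; exact: cut5_flip.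
have [a [pa fa ar as_]] := @cross_pair_true (up fs b) (up fr c) r s (upC _ _ cs)
  (upC _ _ cr) (upN _ _ _ su) (upN _ _ _ sv) (upN _ _ _ ss) (upN _ _ _ ru)
  (upN _ _ _ rv) (upN _ _ _ rr) fr0 fs0 rs (upT _ _ _ sr) (upT _ _ _ rs1).
by exists a, b; split=> //; rewrite -pa /up; case: (b); rewrite ?part_flip.
Qed.

End PairMinDegree5.

(** * Minimum degree 5: no side with two vertices *)

Section EndMinDegree5.
Variable G : sgraph.
Implicit Types (f g : G -> option bool) (C D K E : {set G}).
Hypothesis cG : critical G.
Hypothesis deg5 : forall v : G, 5 <= degree v.

Lemma pair_sub f p q z : cut5 f -> part f (Some true) = [set p; q] ->
  adj p z -> z = q \/ f z = None.
Proof.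
move=> [sf _ _] fpq pz; have := sf p z true pz; rewrite (_ : f p = Some true); last first.
  by apply/eqP; have /setP/(_ p) := fpq; rewrite !inE eqxx.
case fz: (f z) => [[]|] //=; [|by move/(_ erefl)|by right]; left.
have : z \in [set p; q] by rewrite -fpq inE fz.
by rewrite !inE => /orP[]/eqP // zp; move: pz; rewrite zp adjxx.
Qed.

(** Only [q] and the five cut vertices can be neighbours of [p], so degree 5 allows a single
    miss. *)
Lemma pair_nbrs_deg f p q t : 5 <= degree p ->
  cut5 f -> part f (Some true) = [set p; q] -> f t = None ->
  ~~ adj p t -> forall z, adj p z = (z == q) || (f z == None) && (z != t).
Proof.
move=> dp cf fpq ft pt z; have [_ f5 _] := cf.
pose N := q |: (part f None :\ t).
suff /eqP/setP/(_ z) : [set y | adj p y] == N by rewrite !inE andbC.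
rewrite eqEcard; apply/andP; split.
  apply/subsetP => y; rewrite !inE => py; case: (pair_sub cf fpq py) => [->|->].
    by rewrite eqxx.
  by rewrite eqxx andbT (contraTneq _ py) ?orbT // => ->.
apply: leq_trans dp; rewrite cardsU1 cardsDS ?sub1set ?inE ?ft // cards1 f5.
exact: (leq_add (leq_b1 _) (leqnn 4)).
Qed.

Lemma pair_nbrs f p q t : cut5 f -> part f (Some true) = [set p; q] -> f t = None ->
  ~~ adj p t -> forall z, adj p z = (z == q) || (f z == None) && (z != t).
Proof. exact: pair_nbrs_deg. Qed.

(** Every [t] of the cut lies in a 5-cut with both [u] and [v]. If [u] sees [t], a cut through [u]
    and [t] contains [v], because [v] misses nothing; if not, [t] is the only vertex that [u]
    misses, and a cut through [v] and [t] contains [u]. *)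
Lemma pair_full f u v : cut5 f -> part f (Some true) = [set u; v] -> u != v ->
  ~ (forall t, f t = None -> adj v t).
Proof.
move=> cf fuv uv full; have [_ f5 _] := cf.
have fvu : part f (Some true) = [set v; u] by rewrite fuv setUC.
have has_cut t : f t = None -> exists g, [/\ cut5 g, g u = None, g v = None & g t = None].
  move=> ft; have [ut|ut] := boolP (adj u t).
    have [g [cg gu gt]] := edge_cut_deg5 cG deg5 ut; exists g; split=> //.
    case gv: (g v) => [b|] //.
    by have [z [fz _ vz _]] := pair_nonnbr cG cf fuv cg gu gv; rewrite full in vz.
  have [g [cg gv gt]] := edge_cut_deg5 cG deg5 (full t ft); exists g; split=> //.
  case gu: (g u) => [b|] //; rewrite eq_sym in uv.
  have [z [fz _ uz gz]] := pair_nonnbr cG cf fvu cg gv gu.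
  move: uz; rewrite (pair_nbrs cf fuv ft ut) fz eqxx /= negb_or negbK => /andP[_ /eqP zt].
  by rewrite zt gt in gz.
have /card_gt0P[s] : 0 < #|part f None| by rewrite f5.
rewrite inE => /eqP fs0; have [fs [cs su sv ss]] := has_cut s fs0; have [ssep s5 _] := cs.
have X r : f r = None -> r != s ->
    exists a b, [/\ part fs (Some b) = [set r; a], f a = None, a != r & ~~ adj a s].
  move=> fr0 rs; have [fr [cr ru rv rr]] := has_cut r fr0.
  exact: (cross_pair cG deg5 cf fuv uv cs cr).
(* Each side of [fs] is a pair [{r, a}] of vertices of the cut [f]. Applying [X] to [r] shows that
   [s] misses [a], and applying it to [a] shows that [s] misses [r]. *)
have far_s z : adj s z -> fs z = None.
  move=> sz; case sz0: (fs z) => [b|] //.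
  have [_ nt nf] := pair_cut5 cG deg5 cf fuv uv cs su sv fs0 ss.
  have /card_gt0P[r] : 0 < ncell f fs None (Some b) by case: (b); rewrite ?nt ?nf.
  rewrite inE => /andP[/eqP fr0 /eqP sr].
  have rs : r != s by apply: contra_eqN ss => /eqP <-; rewrite sr.
  have [a [b' [pa fa ar as_]]] := X r fr0 rs.
  have bb' : b' = b.
    have : r \in part fs (Some b') by rewrite pa !inE eqxx.
    by rewrite inE sr => /eqP[].
  rewrite {}bb' in pa; have sa : fs a = Some b.
    have : a \in part fs (Some b) by rewrite pa !inE eqxx orbT.
    by rewrite inE => /eqP.
  have a_s : a != s by apply: contra_eqN ss => /eqP <-; rewrite sa.
  have [a' [e [pa' fa' a'a a's]]] := X a fa a_s.
  have eb : e = b.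
    have : a \in part fs (Some e) by rewrite pa' !inE eqxx.
    by rewrite inE sa => /eqP[].
  rewrite {}eb in pa'; have : z \in part fs (Some b) by rewrite inE sz0.
  have : r \in part fs (Some b) by rewrite inE sr.
  rewrite {1}pa' pa !inE eq_sym (negbTE ar) /= => /eqP ra' /orP[]/eqP E.
    by move: a's; rewrite -ra' -E adjC sz.
  by move: as_; rewrite -E adjC sz.
have : degree s <= #|part fs None :\ s|.
  apply/subset_leq_card/subsetP => z; rewrite !inE => sz.
  by rewrite far_s // eqxx andbT eq_sym adj_neq.
by rewrite cardsDS ?sub1set ?inE ?ss // cards1 s5 leqNgt deg5.
Qed.

(** Crossing the cuts through [s] and through [r] produces two further two-vertex sides, [{r, a}]
    and [{s, b}]. In all three pairs each vertex misses exactly one vertex of its cut, so the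
    neighbourhoods of [u], [v], [a], [b], [r], [s] are known exactly. A cut [g] through [a] and [u]
    also contains [r] and [b], and the side of [g] with [v] is then too small to give its vertex [e]
    degree 5. *)
Lemma pair_thin f u v r s : cut5 f -> part f (Some true) = [set u; v] -> u != v ->
  f r = None -> f s = None -> ~~ adj u r -> ~~ adj v s -> False.
Proof.
move=> cf fuv uv fr0 fs0 ur vs; have [_ f5 _] := cf.
have fvu : part f (Some true) = [set v; u] by rewrite fuv setUC.
have vu : v != u by rewrite eq_sym.
have Nu := pair_nbrs cf fuv fr0 ur; have Nv := pair_nbrs cf fvu fs0 vs.
have rs : r != s.
  apply/eqP => E; have [z fz rz] := cut_nbr cG true cf fr0.
  have : z \in [set u; v] by rewrite -fuv inE fz.
  rewrite !inE => /orP[]/eqP zE; rewrite adjC zE in rz; first by rewrite rz in ur.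
  by rewrite -E rz in vs.
have us : adj u s by rewrite Nu fs0 eqxx [s == r]eq_sym rs orbT.
have vr : adj v r by rewrite Nv fr0 eqxx rs orbT.
have [fs [cs su ss]] := edge_cut_deg5 cG deg5 us.
have sv : fs v = None.
  case sv: (fs v) => [b|] //; have [z [fz _ vz sz]] := pair_nonnbr cG cf fuv cs su sv.
  move: vz; rewrite Nv fz eqxx negb_or negbK => /andP[_ /eqP zs].
  by rewrite zs ss in sz.
have [fr [cr rv rr]] := edge_cut_deg5 cG deg5 vr.
have ru : fr u = None.
  case ru: (fr u) => [b|] //; have [z [fz _ uz rz]] := pair_nonnbr cG cf fvu cr rv ru.
  move: uz; rewrite Nu fz eqxx negb_or negbK => /andP[_ /eqP zr].
  by rewrite zr rr in rz.
have [sn1 _ _] := pair_cut5 cG deg5 cf fuv uv cs su sv fs0 ss.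
have [a [b0 [pa0 fa ar as_]]] := cross_pair cG deg5 cf fuv uv cs cr su sv ss ru rv rr fr0 fs0 rs.
have sr : s != r by rewrite eq_sym.
have [b [b1 [pb0 fb bs br]]] := cross_pair cG deg5 cf fuv uv cr cs ru rv rr su sv ss fs0 fr0 sr.
have {b0 pa0} [hs [chs pa hsN]] : exists hs, [/\ cut5 hs, part hs (Some true) = [set r; a] &
    part hs None = part fs None].
  case: b0 pa0 => pa0; first by exists fs.
  by exists (flip fs); rewrite part_flip part_flipN; split=> //; exact: cut5_flip.
have {b1 pb0} [hr [chr pb hrN]] : exists hr, [/\ cut5 hr, part hr (Some true) = [set s; b] &
    part hr None = part fr None].
  case: b1 pb0 => pb0; first by exists fr.
  by exists (flip fr); rewrite part_flip part_flipN; split=> //; exact: cut5_flip.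
have eqN (h k : G -> option bool) : part h None = part k None -> forall z, (h z == None) = (k z == None).
  by move=> /setP E z; have := E z; rewrite !inE.
have {}hsN := eqN _ _ hsN; have {}hrN := eqN _ _ hrN.
have hN (h k : G -> option bool) z : (forall z, (h z == None) = (k z == None)) -> k z = None -> h z = None.
  by move=> E kz; apply/eqP; rewrite E kz.
have hss := hN hs fs s hsN ss; have hsu := hN hs fs u hsN su; have hsv := hN hs fs v hsN sv.
have hrr := hN hr fr r hrN rr; have hru := hN hr fr u hrN ru; have hrv := hN hr fr v hrN rv.
have pa' : part hs (Some true) = [set a; r] by rewrite pa setUC.
have pb' : part hr (Some true) = [set b; s] by rewrite pb setUC.
have Na := pair_nbrs chs pa' hss as_; have Nb := pair_nbrs chr pb' hrr br.
have ru' : ~~ adj r u by rewrite adjC. have sv' : ~~ adj s v by rewrite adjC.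
have Nr := pair_nbrs chs pa hsu ru'; have Ns := pair_nbrs chr pb hrv sv'.
have au : adj a u by rewrite adjC Nu fa eqxx ar orbT.
have [g [cg ga gu]] := edge_cut_deg5 cG deg5 au; have [gsep g5 g2] := cg.
have gr : g r = None.
  case gr: (g r) => [c|] //.
  have [z [hz _ rz gz]] := pair_nonnbr cG chs pa' cg ga gr.
  move: rz; rewrite Nr hz eqxx negb_or negbK => /andP[_ /eqP zu].
  by rewrite zu gu in gz.
have ra : r != a by rewrite eq_sym.
have [gn1 gnt gnf] := pair_cut5 cG deg5 chs pa ra cg gr ga hsu gu.
case gv: (g v) => [c|]; last by have := ncell_gt1 hsu gu hsv gv uv; rewrite gn1.
have sides x y : g x = Some c -> g y = Some (~~ c) -> ~~ adj x y.
  by move=> gx gy; apply/negP => xy; case: (gsep x y c xy gx).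
(* A neighbour of [u] on the side of [g] away from [v] is not adjacent to [v]; only [s] is
   possible. *)
have gs : g s = Some (~~ c).
  have [z gz uz] := cut_nbr cG (~~ c) cg gu.
  have := sides v z gv gz; move: uz; rewrite Nu Nv => /orP[/eqP zv|/andP[-> _]].
    by rewrite zv gv in gz; case: (c) gz.
  by rewrite /= negb_or negbK => /andP[_ /eqP <-].
have gb : g b = None.
  case gb: (g b) => [e|] //; have bc : adj v b by rewrite Nv fb eqxx bs orbT.
  have sb : adj s b by rewrite Ns eqxx.
  case: (eqVneq e c) => ec; first by have := sides b s; rewrite gb ec gs adjC sb => /(_ erefl erefl).
  have := sides v b gv; rewrite bc gb; case: (e) ec; case: (c) => // _ /(_ erefl) //.
have n2 : ncell hs g None (Some c) = 2 by case: (c); rewrite ?gnt ?gnf.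
have [e ev eE] : exists2 e, e != v & cell hs g None (Some c) = [set v; e].
  by apply: cards2_other; rewrite ?inE ?hsv ?gv ?eqxx.
have : e \in cell hs g None (Some c) by rewrite eE !inE eqxx orbT.
rewrite inE => /andP[/eqP he /eqP ge].
have inMs z : hs z = None -> g z = Some c -> z = v \/ z = e.
  move=> hz gz; have : z \in [set v; e] by rewrite -eE inE hz gz !eqxx.
  by rewrite !inE => /orP[]/eqP; [left|right].
have es : e != s by apply: contra_eqN ge => /eqP ->; rewrite gs; case: (c).
have eu : e != u by apply: contra_eqN ge => /eqP ->; rewrite gu.
have fe : f e != None.
  apply/eqP => fe; have se : fs e = None by apply/eqP; rewrite -hsN he.
  by have := ncell_gt1 fe se fs0 ss es; rewrite sn1.
(* The vertices on the side of [v] other than [v] and those in [D] have no neighbour among [v], [a],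
   [u], [r], [b], so [D] bounds them. It has at most 1 + (5 - 4) + (5 - 4) = 3 vertices, hence
   nothing is left on this side beyond [v] and [D]. *)
pose D := e |: ((part f None :\: [set r; s; a; b]) :|: (part g None :\: [set a; u; r; b])).
have ab : a != b by apply: contraNneq as_ => ->; rewrite Nb eqxx.
have as0 : a != s.
  apply/eqP => E; have : a \in part hs (Some true) by rewrite pa !inE eqxx orbT.
  by rewrite inE E hss.
have br0 : b != r.
  apply/eqP => E; have : b \in part hr (Some true) by rewrite pb !inE eqxx orbT.
  by rewrite inE E hrr.
have ua : u != a by rewrite eq_sym adj_neq.
have [uT vT] : f u != None /\ f v != None.
  have inE' z : z \in [set u; v] -> f z != None by rewrite -fuv inE => /eqP ->.
  by split; apply: inE'; rewrite !inE eqxx ?orbT.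
have uNT z : f z = None -> u != z by move=> fz; apply: contraNneq uT => ->; rewrite fz.
have D3 : #|D| <= 3.
  have c1 : #|part f None :\: [set r; s; a; b]| = 1.
    rewrite cardsDS ?f5.
      rewrite (_ : #|[set r; s; a; b]| = 4) //.
      apply: (@eq_trans _ _ #|[:: r; s; a; b]|).
        by apply: eq_card => z; rewrite !inE -!orbA.
      have /card_uniqP-> // : uniq [:: r; s; a; b].
      by rewrite /= !inE !negb_or rs ra ab [r == b]eq_sym br0 [s == a]eq_sym as0 [s == b]eq_sym bs.
    by apply/subsetP => z; rewrite !inE -!orbA => /or4P[]/eqP ->; rewrite ?fr0 ?fs0 ?fa ?fb.
  have c2 : #|part g None :\: [set a; u; r; b]| = 1.
    rewrite cardsDS ?g5.
      rewrite (_ : #|[set a; u; r; b]| = 4) //.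
      apply: (@eq_trans _ _ #|[:: a; u; r; b]|).
        by apply: eq_card => z; rewrite !inE -!orbA.
      have /card_uniqP-> // : uniq [:: a; u; r; b].
      by rewrite /= !inE !negb_or [a == u]eq_sym ua ar ab [r == b]eq_sym br0 !uNT.
    by apply/subsetP => z; rewrite !inE -!orbA => /or4P[]/eqP ->; rewrite ?gr ?ga ?gu ?gb.
  rewrite /D cardsU1; apply: leq_trans (_ : 1 + 2 <= _) => //; apply: leq_add.
    exact: leq_b1.
  by apply: leq_trans (leq_card_setU _ _) _; rewrite c1 c2.
have inT z : z \notin D -> g z = Some c -> f z <> None.
  move=> zD gz fz; have : z \in [set r; s; a; b].
    by apply: contraR zD => zn; rewrite in_setU1 in_setU in_setD zn inE fz eqxx orbT.
  rewrite !inE -!orbA; case/or4P=> /eqP E; rewrite E ?gr ?gs ?ga ?gb in gz => //.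
  by case: (c) gz.
have gN z : z \notin D -> g z = None -> [|| z == a, z == u, z == r | z == b].
  move=> zD gz; suff : z \in [set a; u; r; b] by rewrite !inE -!orbA.
  apply: contraR zD => zn.
  by rewrite in_setU1 !in_setU in_setD [in X in _ || X]in_setD zn !inE gz eqxx !orbT.
have nbr_u z : g z = Some c -> z != v -> f z <> None -> ~~ adj u z.
  move=> gz zv fz; rewrite Nu (negbTE zv) /=.
  by case: eqP => // /fz.
have nbr_v z : g z = Some c -> f z <> None -> ~~ adj v z.
  move=> gz fz; rewrite Nv negb_or; apply/andP; split; last by case: eqP => // /fz.
  by apply: contra_eqN gz => /eqP ->; rewrite gu.
have nbr_b z : g z = Some c -> z != v -> ~~ adj b z.
  move=> gz zv; apply/negP; rewrite Nb => /orP[/eqP zs|/andP[/eqP hz zr]].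
    by rewrite zs gs in gz; case: (c) gz.
  have := sides z s gz gs; by rewrite adjC Ns hz zv orbT.
have cover z : g z = Some c -> z \in v |: D.
  move=> gz; apply: contraTT isT => zvD; exfalso.
  pose C := part g (Some c) :\: (v |: D).
  suff : 4 <= #|D| by rewrite leqNgt ltnS D3.
  apply: (conn4 cG) (_ : bounds D C) _ _.
  - move=> x y; rewrite inE => /andP[]; rewrite in_setU1 negb_or => /andP[xv xD].
    rewrite inE => /eqP gx xy; have fx := inT x xD gx.
    rewrite in_setU in_setD in_setU1 negb_or.
    have [//|yD] := boolP (y \in D); first by rewrite orbT.
    rewrite orbF andbT; have yv : y != v by apply: contraTneq xy => ->; rewrite adjC nbr_v.
    rewrite yv inE /=; have := gsep x y c xy gx; case gy: (g y) => [d|]; first by case: (d); case: (c).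
    move=> _; exfalso; have H := gN y yD gy.
    have xe : x != e by apply: contraNneq xD => ->; rewrite !inE eqxx.
    have hx : hs x <> None by move=> hx; case: (inMs x hx gx) => E; [rewrite E eqxx in xv | rewrite E eqxx in xe].
    case/or4P: H => /eqP E; rewrite E adjC in xy.
    + move: xy; rewrite Na => /orP[/eqP xr|/andP[/eqP //]].
      by rewrite xr gr in gx.
    + by rewrite (negbTE (nbr_u x gx xv fx)) in xy.
    + move: xy; rewrite Nr => /orP[/eqP xr|/andP[/eqP //]].
      by rewrite xr ga in gx.
    + by rewrite (negbTE (nbr_b x gx xv)) in xy.
  - by apply/card_gt0P; exists z; rewrite !in_setD zvD inE gz eqxx.
  - apply: leq_trans (_ : #|[set s]| <= _); first by rewrite cards1.
    apply/subset_leq_card/subsetP => x; rewrite inE => /eqP ->.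
    have sN : (s \in part g (Some c) = false) * (s \in part g None = false).
      by rewrite !inE gs; split=> //; case: (c).
    rewrite in_setC in_setU in_setD sN andbF orFb in_setU1 in_setU !in_setD sN andbF orbF.
    by rewrite [s == e]eq_sym (negbTE es) !inE eqxx orbT.
(* [e] misses [u], [v] and [b], which leaves at most 2 + 2 neighbours. *)
have : degree e <= #|(D :\ e) :|: [set a; r]|.
  apply/subset_leq_card/subsetP => z; rewrite inE => ez.
  have ze : z != e by rewrite eq_sym adj_neq.
  rewrite in_setU in_setD1 ze /= in_set2.
  have fe' : f e <> None by apply/eqP.
  have zv : z != v by apply: contraTneq ez => ->; rewrite adjC nbr_v.
  case gz: (g z) => [d|].
    have gz' : g z = Some c by have := gsep e z c ez ge; rewrite gz; case: (d); case: (c).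
    by have := cover z gz'; rewrite in_setU1 (negbTE zv) orFb => ->.
  have [//|zD] := boolP (z \in D).
  have := gN z zD gz; rewrite orFb => /or4P[]/eqP E; rewrite E ?eqxx ?orbT //.
    by move: ez; rewrite E adjC (negbTE (nbr_u e ge ev fe')).
  by move: ez; rewrite E adjC (negbTE (nbr_b e ge ev)).
move=> de; have := leq_trans (leq_trans (deg5 e) de) (leq_card_setU _ _).
rewrite cardsDS ?sub1set ?inE ?eqxx // cards1 cards2 ar.
by move: D3; move: #|D| => k; clear; lia.
Qed.

Lemma critical_deg5 : (exists f : G -> option bool, cut5 f) -> False.
Proof.
case=> f0 c0.
have main n : forall f, cut5 f -> #|part f (Some true)| = n -> False.
  elim/ltn_ind: n => n IH f cf fn.
  have minf g : cut5 g -> n <= #|part g (Some true)|.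
    by move=> cg; rewrite leqNgt; apply/negP => lt; exact: (IH _ lt g cg).
  have n2 := min_side2 cG deg5 cf fn minf.
  have /cards2P[u [v [uv fuv]]] : #|part f (Some true)| == 2 by rewrite fn n2.
  have fvu : part f (Some true) = [set v; u] by rewrite fuv setUC.
  have vu : v != u by rewrite eq_sym.
  case: (boolP [forall t, (f t == None) ==> adj v t]) => [/forallP H|].
    by apply: (pair_full cf fuv uv) => t ft; have := H t; rewrite ft eqxx.
  rewrite negb_forall => /existsP[s]; rewrite negb_imply => /andP[/eqP fs vs].
  case: (boolP [forall t, (f t == None) ==> adj u t]) => [/forallP H|].
    by apply: (pair_full cf fvu vu) => t ft; have := H t; rewrite ft eqxx.
  rewrite negb_forall => /existsP[r]; rewrite negb_imply => /andP[/eqP fr ur].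
  exact: (pair_thin cf fuv uv fr fs ur vs).
exact: main c0 erefl.
Qed.

End EndMinDegree5.

(** * A vertex of degree 4: cuts through its neighbours *)

Section PairAdj.
Variable G : sgraph.
Implicit Types (f g : G -> option bool) (C D K E : {set G}).
Hypothesis cG : critical G.

Lemma deg_nbr_of4 (v z : G) : degree v <= 4 -> adj v z -> 5 <= degree z.
Proof.
move=> dv vz; rewrite ltnNge; apply/negP => dz.
by have [] := far cG (adj_neq vz) dv dz; rewrite vz.
Qed.

Lemma deg_dist2_of4 (v y z : G) : degree v <= 4 -> adj v y -> adj y z -> z != v ->
  5 <= degree z.
Proof.
move=> dv vy yz zv; rewrite ltnNge; apply/negP => dz; rewrite eq_sym in zv.
by have [_ /(_ y vy)] := far cG zv dv dz; rewrite adjC yz.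
Qed.

(** Excludes the second outcome of [pair_cut] for an adjacent pair. The neighbours of [v] are [t]
    and the three vertices of the cut other than [p] and [q]. A cut through [v] and one of these
    three shows that [t] misses another of them; doing this twice, [t] misses two cut vertices and
    has degree at most 4, too little for a neighbour of [v]. *)
Lemma no_deg4_side g (s : bool) t v p q : cut5 g -> part g (Some s) = [set t; v] ->
  t != v -> degree v <= 4 ->
  (forall z, adj v z = (z == t) || [&& g z == None, z != p & z != q]) ->
  g p = None -> g q = None -> p != q -> adj p q -> False.
Proof.
move=> cg gtv tv dv Nv gp gq pq apq.
have {s gtv} [h [ch htv hN]] : exists h, [/\ cut5 h, part h (Some true) = [set v; t] &
    forall z, (h z == None) = (g z == None)].
  case: s gtv => gtv; first by exists g; rewrite setUC.
  exists (flip g); rewrite part_flip setUC; split=> //; first exact: cut5_flip.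
  by move=> z; rewrite /flip; case: (g z).
have {}Nv z : adj v z = (z == t) || [&& h z == None, z != p & z != q] by rewrite Nv hN.
have hp : h p = None by apply/eqP; rewrite hN gp.
have hq : h q = None by apply/eqP; rewrite hN gq.
have vt : adj v t by rewrite Nv eqxx.
have vt0 : v != t by rewrite eq_sym.
have ht : h t = Some true.
  by apply/eqP; have /setP/(_ t) := htv; rewrite !inE eqxx orbT.
have claim c : h c = None -> c != p -> c != q ->
    exists z, [/\ h z = None, z != p, z != q, z != c & ~~ adj t z].
  move=> hc cp cq; have vc : adj v c by rewrite Nv hc cp cq orbT.
  have [|k [ck kv kc]] := edge_cut cG vc.
    by move=> z vz _; exact: deg_nbr_of4 dv vz.
  have ctp : c != t by apply: contra_eqN hc => /eqP ->; rewrite ht.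
  (* If [k] contains [t], then [pair_cut] applies to the side [{v, t}]. A split 1, 2, 2 puts the
     adjacent vertices [p] and [q] on one side, where [v] has a third neighbour in the cut; the
     other outcome gives a second vertex of degree 4 adjacent to [c]. *)
  case kt: (k t) => [e|]; last first.
    exfalso; case: (pair_cut cG ch htv vt0 ck kv kt hc kc).
      case=> n1 nt nf.
      have split_ z : h z = None -> z != c -> k z <> None.
        by move=> hz zc kz; have := ncell_gt1 hz kz hc kc zc; rewrite n1.
      have [pc qc] : p != c /\ q != c by rewrite ![_ == c]eq_sym.
      case kp: (k p) => [e|]; last exact: split_ hp pc kp.
      have kq : k q = Some e.
        case kq: (k q) => [e'|]; last by case: (split_ q hq qc kq).
        have [ks _ _] := ck; have := ks p q e apq kp; rewrite kq.
        by case: (e); case: (e').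
      have [|z vz [hz kz]] := @pair_nbr _ cG h k v t ch htv ck kv e; first by rewrite kt.
      move: vz; rewrite Nv => /orP[/eqP zt|/and3P[_ zp zq]]; first by rewrite zt ht in hz.
      have := ncell_gt2 hp kp hq kq hz kz pq; rewrite ![_ == z]eq_sym => /(_ zp zq).
      by case: (e); rewrite ?nt ?nf.
    case=> [s [v' [t' [ks tv' _ dv' Nv']]]].
    have v'c : adj v' c.
      rewrite Nv' kc eqxx ctp andbT /= orbC; apply/orP; left.
      by rewrite eq_sym adj_neq.
    have v'v : v != v'.
      apply/eqP => E; have : v' \in part k (Some s) by rewrite ks !inE eqxx orbT.
      by rewrite inE -E kv.
    by have [_ /(_ c vc)] := far cG v'v dv dv'; rewrite v'c.
  have [z [hz vz tz kz]] := pair_nonnbr cG ch htv ck kv kt.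
  move: vz; rewrite Nv => /orP[/eqP zt|/and3P[_ zp zq]]; first by rewrite zt ht in hz.
  by exists z; split=> //; apply: contra_eqN kz => /eqP ->; rewrite kc.
have [_ h5 _] := ch.
have /card_gt0P[c] : 0 < #|part h None :\: [set p; q]|.
  rewrite cardsDS ?h5 ?cards2 ?pq //.
  by apply/subsetP => z; rewrite !inE => /orP[]/eqP ->; rewrite ?hp ?hq.
rewrite !inE negb_or => /andP[/andP[cp cq] /eqP hc].
have [x [hx xp xq _ tx]] := claim c hc cp cq.
have [y [hy _ _ yx ty]] := claim x hx xp xq.
have : degree t <= #|v |: (part h None :\: [set x; y])|.
  apply/subset_leq_card/subsetP => z; rewrite !inE negb_or => tz.
  have htv' : part h (Some true) = [set t; v] by rewrite htv setUC.
  case: (pair_sub ch htv' tz) => [->|->]; first by rewrite eqxx.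
  rewrite eqxx andbT; apply/orP; right.
  by rewrite (contraTneq _ tz) ?(contraTneq _ tz) // => ->.
have := deg_nbr_of4 dv vt; rewrite cardsU1 cardsDS ?h5 ?cards2 1?eq_sym ?yx.
  by move=> d5 /(leq_trans d5); case: (v \notin _).
by apply/subsetP => z; rewrite !inE => /orP[]/eqP ->; rewrite ?hx ?hy.
Qed.

Lemma pair_cut_adj f g p q y : cut5 f -> part f (Some true) = [set p; q] -> adj p q ->
  cut5 g -> g p = None -> g q = None -> f y = None -> g y = None ->
  [/\ ncell f g None None = 1, ncell f g None (Some true) = 2 & ncell f g None (Some false) = 2].
Proof.
move=> cf fpq apq cg gp gq fy gy; have pq := adj_neq apq.
case: (pair_cut cG cf fpq pq cg gp gq fy gy) => // -[s [v [t [gs tv _ dv Nv]]]].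
by case: (no_deg4_side cg gs tv dv Nv gp gq pq apq).
Qed.

End PairAdj.

(** * How cuts through a vertex of degree 4 split its neighbours *)

Section DegreeFour.
Variable G : sgraph.
Implicit Types (f g : G -> option bool) (C D K E : {set G}).
Hypothesis cG : critical G.
Variable u : G.
Hypothesis du : degree u <= 4.

Definition nbs (a b c d : G) :=
  uniq [:: a; b; c; d] /\ forall z, adj u z = (z \in [:: a; b; c; d]).

Lemma nbs_perm a b c d a' b' c' d' : nbs a b c d ->
  perm_eq [:: a; b; c; d] [:: a'; b'; c'; d'] -> nbs a' b' c' d'.
Proof.
case=> U H P; split; first by rewrite -(perm_uniq P).
by move=> z; rewrite H (perm_mem P).
Qed.

Lemma nbs_ex : exists a b c d, nbs a b c d.
Proof.
have c4 : size (enum [set y | adj u y]) = 4.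
  by rewrite -cardE; apply/eqP; rewrite eqn_leq du (deg_ge4 cG u).
have H z : adj u z = (z \in enum [set y | adj u y]) by rewrite mem_enum inE.
have := enum_uniq [set y | adj u y].
case: (enum _) c4 H => [|a [|b [|c [|d []]]]] // _ H U.
by exists a, b, c, d.
Qed.

(* A vertex of degree 4 other than [u] is not adjacent to [d], so it cannot form
   the corner alone with a boundary of size 4. *)
Lemma corner_far f g (b c : bool) K E d : cut5 f -> separates g -> f u = None ->
  K \subset wall f g b c -> E \subset cell f g (Some b) (Some c) ->
  (forall k z, k \in K -> f z = Some b -> g z = Some c -> z \notin E -> ~~ adj k z) ->
  d \in (wall f g b c :\: K) :|: E -> (d == u) || adj u d ->
  #|E| < ncell f g (Some b) (Some c) -> 5 + #|K| <= #|wall f g b c| + #|E|.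
Proof.
move=> cf sg fu sK sE nK dD ud lt; apply: corner5 => // v Cv dv.
exists d => //; have : v \in [set v] by rewrite inE.
rewrite -Cv !inE => /andP[_ /andP[/eqP fv _]].
have vu : u != v by apply: contra_eqN fv => /eqP <-; rewrite fu.
have [uv nuv] := far cG vu du dv.
by case/orP: ud => [/eqP ->|/nuv //]; rewrite adjC.
Qed.

Lemma corner_u5 f g (b c : bool) : cut5 f -> separates g -> f u = None -> g u = None ->
  0 < ncell f g (Some b) (Some c) -> 5 <= #|wall f g b c|.
Proof.
move=> cf sg fu gu n0; rewrite -[5]addn0 -[X in _ <= X]addn0.
have := @corner_far f g b c set0 set0 u cf sg fu (sub0set _) (sub0set _).
rewrite cards0 !addn0; apply; rewrite ?eqxx //; first by move=> k z; rewrite inE.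
by rewrite !inE fu gu !eqxx ?orbT.
Qed.

Lemma corner_u6 f g (b c : bool) t : cut5 f -> separates g -> f u = None -> g u = None ->
  (forall z, adj u z -> f z = Some b -> g z <> Some c) -> adj u t -> t \in wall f g b c ->
  0 < ncell f g (Some b) (Some c) -> 6 <= #|wall f g b c|.
Proof.
move=> cf sg fu gu free ut tw n0.
have := @corner_far f g b c [set u] set0 t cf sg fu _ (sub0set _).
rewrite cards0 cards1 addn0; apply=> //.
- by rewrite sub1set !inE fu gu !eqxx ?orbT.
- by move=> k z; rewrite inE => /eqP -> fz gz _; apply/negP => uz; case: (free z uz fz).
- by rewrite setU0 inE tw andbT inE eq_sym adj_neq.
by rewrite ut orbT.
Qed.

(* The neighbours of [u] are split as [b | c, d] by a cut through [u] and [a],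
   respectively as [c | d] by a cut through [u], [a] and [b]. *)
Definition cut1 f a b c d := [/\ cut5 f, f u = None, f a = None, f b = Some true &
  f c = Some false /\ f d = Some false].

Definition cut2 f a b c d := [/\ cut5 f, f u = None, f a = None, f b = None &
  f c = Some true /\ f d = Some false].

Lemma nbs_adj a b c d : nbs a b c d -> [/\ adj u a, adj u b, adj u c & adj u d].
Proof. by case=> _ H; rewrite !H !inE !eqxx !orbT. Qed.

Lemma cut_at a : adj u a -> exists f, [/\ cut5 f, f u = None & f a = None].
Proof. by move=> ua; apply: (edge_cut cG ua) => z uz _; exact: deg_nbr_of4 cG _ _ du uz. Qed.

(** On its side of [f], [b] is the only neighbour of [u], and [g] contains it. So each corner on
    that side is empty or has a wall of at least 6, in which case the opposite corner is empty by
    [corner_u5]. Since [u] has a neighbour on each side of [g], counting leaves both corners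
    empty. *)
Lemma cut1_cross f g a b c d : nbs a b c d -> cut1 f a b c d -> cut5 g -> g u = None ->
  g b = None ->
  g a <> None /\ [/\ ncell f g (Some true) None = 2, ncell f g None None = 1,
    forall s : bool, ncell f g (Some true) (Some s) = 0 &
    forall s : bool, ncell f g None (Some s) = 2].
Proof.
move=> N [cf fu fa fb [fc fd]] cg gu gb; have [[U H] [ua ub uc ud]] := (N, nbs_adj N).
have [sf f5 f2] := cf; have [sg g5 g2] := cg.
have free (s : bool) : 0 < ncell f g (Some true) (Some s) -> 6 <= #|wall f g true s|.
  apply: corner_u6 (ub) _ => //; last by rewrite !inE fb gb !eqxx.
  move=> z; rewrite H !inE => /or4P[]/eqP -> fz //; first by rewrite fz in fa.
  - by rewrite gb.
  - by rewrite fz in fc.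
  - by rewrite fz in fd.
have side (s : bool) : [|| g a == Some s, g c == Some s | g d == Some s].
  have [z gz uz] := cut_nbr cG s cg gu; move: uz; rewrite H !inE.
  case/or4P=> /eqP E; rewrite {}E in gz; rewrite ?gz ?eqxx ?orbT //.
  by rewrite gb in gz.
have f1 := free true; have f0 := free false.
have h1 := @corner_u5 f g false true cf sg fu gu.
have h0 := @corner_u5 f g false false cf sg fu gu.
have m1 := ncell_gt0 fu gu; have m2 := ncell_gt0 fb gb.
have m3 := @ncell_gt0 _ f g _ _ a fa erefl; have m4 := @ncell_gt0 _ f g _ _ c fc erefl.
have m5 := @ncell_gt0 _ f g _ _ d fd erefl.
have m6 : g a = None -> 1 < ncell f g None None.
  by move=> ga; apply: (ncell_gt1 fu gu fa ga); rewrite adj_neq.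
have r0 := ncell_row f g None; have r1 := ncell_row f g (Some true).
have k0 := ncell_col f g None; have k1 := ncell_col f g (Some true).
have k2 := ncell_col f g (Some false).
have x1 := f2 true; have x3 := g2 true; have x4 := g2 false.
have s1 := side true; have s0 := side false; clear side free.
move: f1 f0 h1 h0; rewrite !card_wall f5 in r0 *; rewrite g5 in k0 * => f1 f0 h1 h0.
clear - f1 f0 h1 h0 m1 m2 m3 m4 m5 m6 r0 r1 k0 k1 k2 x1 x3 x4 s1 s0.
suff : g a <> None /\ [/\ ncell f g (Some true) None = 2, ncell f g None None = 1,
    ncell f g (Some true) (Some true) = 0 /\ ncell f g (Some true) (Some false) = 0 &
    ncell f g None (Some true) = 2 /\ ncell f g None (Some false) = 2].
  by case=> ga [e1 e2 [e3 e4] [e5 e6]]; split=> //; split=> // -[].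
case ga: (g a) m3 s1 s0 m6 => [[]|] m3; case gc: (g c) m4 => [[]|] m4;
  case gd: (g d) m5 => [[]|] m5 //= _ _ m6; try (split; [by []|split; lia]);
  by exfalso; have := m6 erefl; clear m6; lia.
Qed.

Lemma cut2_swap f a b c d : cut2 f a b c d -> cut2 f b a c d.
Proof. by case. Qed.

Lemma cut2_flip f a b c d : cut2 f a b c d -> cut2 (flip f) a b d c.
Proof.
case=> cf fu fa fb [fc fd]; split; [exact: cut5_flip | | | |split];
  by rewrite /flip ?fu ?fa ?fb ?fc ?fd.
Qed.

Ltac or_split t := first [by t | left; or_split t | right; or_split t].

(** Each side of the cut contains one of [b], [c], [d], because [u] has a neighbour there. Up to
    exchanging the sides this leaves six patterns. *)
Lemma cut_types f a b c d : nbs a b c d -> cut5 f -> f u = None -> f a = None ->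
  exists g, cut1 g a b c d \/ cut1 g a c b d \/ cut1 g a d b c \/
    cut2 g a b c d \/ cut2 g a c b d \/ cut2 g a d b c.
Proof.
move=> [U H] cf fu fa; have cf' := cut5_flip cf.
have side (s : bool) : [|| f b == Some s, f c == Some s | f d == Some s].
  have [z fz uz] := cut_nbr cG s cf fu; move: uz; rewrite H !inE.
  case/or4P=> /eqP E; rewrite {}E in fz; rewrite ?fz ?eqxx ?orbT //.
  by rewrite fa in fz.
have := side true; have := side false; clear side.
case fb: (f b) => [[]|]; case fc: (f c) => [[]|]; case fd: (f d) => [[]|] //= _ _;
  first [exists f; or_split ltac:(split; [exact: cf| | | |split]; rewrite ?fu ?fa ?fb ?fc ?fd)
        |exists (flip f); or_split ltac:(split; [exact: cf'| | | |split];
           rewrite /flip ?fu ?fa ?fb ?fc ?fd)].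
Qed.

(** Only the corner of [d] contains a neighbour of [u]; the other three are empty or have walls of
    at least 6. Both cuts contain [u] and [a], and no sizes fit. *)
Lemma cut2_pair f g a b c d : nbs a b c d -> cut2 f a b c d -> cut2 g a c b d -> False.
Proof.
move=> N [cf fu fa fb [fc fd]] [cg gu ga gc [gb gd]]; have [[U H] [ua ub uc ud]] := (N, nbs_adj N).
have [sf f5 f2] := cf; have [sg g5 g2] := cg.
have free (s t : bool) : ~~ (~~ s && ~~ t) ->
    0 < ncell f g (Some s) (Some t) -> 6 <= #|wall f g s t|.
  move=> st; apply: corner_u6 (ua) _ => //; last by rewrite !inE fa ga !eqxx orbT.
  move=> z; rewrite H !inE => /or4P[]/eqP -> fz gz.
  - by rewrite fa in fz.
  - by rewrite fb in fz.
  - by rewrite gc in gz.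
  by move: st; move: fz gz; rewrite fd gd => -[<-] [<-].
have f1 := free true true isT; have f0 := free true false isT; have f3 := free false true isT.
have h0 := @corner_u5 f g false false cf sg fu gu.
have m1 := ncell_gt1 fu gu fa ga (adj_neq ua); have m2 := ncell_gt0 fb gb.
have m3 := ncell_gt0 fc gc; have m4 := ncell_gt0 fd gd.
have r0 := ncell_row f g None; have r1 := ncell_row f g (Some true).
have k0 := ncell_col f g None; have k1 := ncell_col f g (Some true).
have x1 := f2 true; have x3 := g2 true; clear free.
rewrite !card_wall in f1 f0 f3 h0; rewrite f5 in r0; rewrite g5 in k0.
clear - f1 f0 f3 h0 m1 m2 m3 m4 r0 r1 k0 k1 x1 x3; lia.
Qed.

(** Here [g] is a vertex. Crossing with a cut through [u] and [b] shows that the side of [b] has two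
    vertices. The second one does not have degree 4: it would then miss [b] and [a], neighbours of
    [u], besides [u] itself, and only three neighbours would remain. So it misses nothing but
    [u]. *)
Lemma lone f a b c d : nbs a b c d -> cut1 f a b c d ->
  exists g : G, [/\ part f (Some true) = [set b; g], g != b, ~~ adj u g &
    forall z, adj g z = (z == b) || (f z == None) && (z != u)].
Proof.
move=> N F; have [cf fu fa fb [fc fd]] := F; have [[U H] [ua ub uc ud]] := (N, nbs_adj N).
have [k [ck ku kb]] := cut_at ub.
have [_ [n1 _ n0 _]] := cut1_cross N F ck ku kb.
have c2 : #|part f (Some true)| = 2 by rewrite (ncell_row f k) n1 !n0.
have bin : b \in part f (Some true) by rewrite inE fb.
have [g gb pE] := cards2_other bin c2.
have fg : f g = Some true.
  by apply/eqP; have /setP/(_ g) := pE; rewrite !inE eqxx orbT.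
have ug : ~~ adj u g.
  rewrite H !inE !negb_or gb; apply/and4P; split=> //;
    by apply: contra_eqN fg => /eqP ->; rewrite ?fa ?fc ?fd.
have pE' : part f (Some true) = [set g; b] by rewrite pE setUC.
exists g; split=> //; apply: (pair_nbrs_deg _ cf pE' fu); last by rewrite adjC.
rewrite ltnNge; apply/negP => dg.
have gu : u != g by apply: contra_eqN fg => /eqP <-; rewrite fu.
have [_ nug] := far cG gu du dg.
have : degree g <= #|part f None :\: [set u; a]|.
  apply/subset_leq_card/subsetP => z; rewrite !inE => gz.
  case: (pair_sub cf pE' gz) => [zb|->]; first by move: (nug b ub); rewrite -zb gz.
  rewrite andbT negb_or; apply/andP; split; apply/eqP => E.
    by move: ug; rewrite -E adjC gz.
  by move: (nug a ua); rewrite -E gz.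
have [_ f5 _] := cf; rewrite cardsDS ?f5 ?cards2 ?(adj_neq ua).
  by move=> /(leq_trans (deg_ge4 cG g)).
by apply/subsetP => z; rewrite !inE => /orP[]/eqP ->; rewrite ?fu ?fa.
Qed.

End DegreeFour.

(** * A neighbour alone on its side, with its companion vertex *)

Section LoneNeighbour.
Variable G : sgraph.
Implicit Types (f g : G -> option bool) (C D K E : {set G}).
Hypothesis cG : critical G.
Variable u : G.
Hypothesis du : degree u <= 4.

Notation nbs := (nbs u).
Notation cut1 := (cut1 u).
Notation cut2 := (cut2 u).

Section Lone.
Variables (f : G -> option bool) (a b c d p : G).
Hypotheses (N : nbs a b c d) (F : cut1 f a b c d).
Hypotheses (fbp : part f (Some true) = [set b; p]) (pb : p != b) (up : ~~ adj u p).
Hypothesis Np : forall z, adj p z = (z == b) || (f z == None) && (z != u).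

Let fpb : part f (Some true) = [set p; b].
Proof. by rewrite fbp setUC. Qed.

Lemma lone_adj : adj b p.
Proof. by rewrite adjC Np eqxx. Qed.

Lemma lone_deg z : adj b z -> z != u -> 5 <= degree z.
Proof. by have [_ ub _ _] := nbs_adj N; exact: deg_dist2_of4 cG _ _ _ du ub. Qed.

(** As a neighbour of [u], [b] has degree at least 5, so it misses at most one cut vertex. *)
Lemma lone_miss z t : f z = None -> f t = None -> ~~ adj b z -> ~~ adj b t -> z = t.
Proof.
have [cf _ _ _ _] := F; have [_ ub _ _] := nbs_adj N.
move=> fz ft bz bt; have := pair_nbrs_deg (deg_nbr_of4 cG du ub) cf fbp ft bt z.
by rewrite (negbTE bz) fz eqxx /= => /esym/norP[_]; rewrite negbK => /eqP.
Qed.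

(* The only vertex in the cut that may have degree 4 is a non-neighbour of [b],
   and the choice of [x] excludes it from the common neighbours of [p] and [x]. *)
Lemma lone_cut x : f x = None -> x != u ->
  (forall z, f z = None -> z != u -> z != x -> adj b z \/ adj u z) ->
  exists k, [/\ cut5 k, k p = None & k x = None].
Proof.
move=> fx xu hx; have [_ ub _ _] := nbs_adj N.
have px : adj p x by rewrite Np fx eqxx xu orbT.
apply: (edge_cut cG px) => z; rewrite Np => /orP[/eqP -> _|/andP[/eqP fz zu] xz].
  exact: deg_nbr_of4 cG _ _ du ub.
case: (hx z fz zu); first by rewrite eq_sym adj_neq.
  by move=> bz; exact: lone_deg.
exact: deg_nbr_of4 cG _ _ du.
Qed.

Lemma lone_opp k (e : bool) : cut5 k -> k p = None -> k b = Some e ->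
  exists z, [/\ f z = None, z != u, ~~ adj b z & k z = Some (~~ e)].
Proof.
have [cf _ _ fb _] := F.
move=> ck kp kb; have [z [fz pz bz kz]] := pair_nonnbr cG cf fpb ck kp kb.
move: pz; rewrite Np => /orP[/eqP zb|/andP[_ zu]]; first by rewrite zb fb in fz.
by exists z.
Qed.

Lemma lone_split k x : cut5 k -> k p = None -> k b = None -> f x = None -> k x = None ->
  [/\ ncell f k None None = 1, ncell f k None (Some true) = 2 & ncell f k None (Some false) = 2].
Proof.
by have [cf _ _ _ _] := F => *; apply: (pair_cut_adj cG cf fbp lone_adj); eauto.
Qed.

End Lone.

(** The sides are [{b, p}] and [{a, h}], with [p] in [g] and [h] in [f], and [m], [m'] are the other
    two vertices of [f]. A cut [k] through [p] and [m] that contains [b] would keep [u], [a], [h] on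
    one side, although only two vertices of [f] fit there. So [k] separates [b] from [a], the side
    of [b] shrinks to [{b, m'}], and [m'] has degree at most 4 although it is a neighbour of [b]. *)
Lemma cut1_swap f g a b c d : nbs a b c d -> cut1 f a b c d -> cut1 g b a c d -> False.
Proof.
move=> N F Gb; have N' : nbs b a c d by apply: nbs_perm N _; apply/permP => P /=; lia.
have [[U H] [ua ub uc ud]] := (N, nbs_adj N).
have [cf fu fa fb [fc fd]] := F; have [cg gu gb ga [gc gd]] := Gb.
have [sf f5 f2] := cf; have [sg g5 g2] := cg.
have [p [fbp pb up Np]] := lone cG du N F; have [h [gah ha uh Nh]] := lone cG du N' Gb.
have [_ [e1 e2 e3 e4]] := cut1_cross cG du N F cg gu gb.
have [_ [e1' _ e3' _]] := cut1_cross cG du N' Gb cf fu fa.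
have inp : f p = Some true.
  by apply/eqP; have /setP/(_ p) := fbp; rewrite !inE eqxx orbT.
have inh : g h = Some true.
  by apply/eqP; have /setP/(_ h) := gah; rewrite !inE eqxx orbT.
have gp : g p = None.
  by case gp: (g p) => [s|] //; have := ncell_gt0 inp gp; rewrite e3.
have fh : f h = None.
  by case fh: (f h) => [s|] //; have := ncell_gt0 inh fh; rewrite e3'.
have hu : h != u by apply: contra_eqN inh => /eqP ->; rewrite gu.
have pa : adj p a by rewrite Np fa eqxx [a == u]eq_sym (adj_neq ua) orbT.
have hb : adj h b by rewrite Nh gb eqxx [b == u]eq_sym (adj_neq ub) orbT.
have ha' : adj h a by rewrite Nh eqxx.
(* [b] misses at most one vertex of [f], so of these two the one called [m'] can be chosen adjacent
   to [b]. *)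
have [m [m' [mm' cm bm']]] : exists m m', [/\ m != m', cell f g None (Some false) = [set m; m']
    & adj b m'].
  have /card_gt0P[m min] : 0 < ncell f g None (Some false) by rewrite e4.
  have [m' m'm cm] := cards2_other min (e4 false).
  have : m' \in cell f g None (Some false) by rewrite cm !inE eqxx orbT.
  move: min; rewrite !inE => /andP[/eqP fm _] /andP[/eqP fm' _].
  have [bm'|bm'] := boolP (adj b m'); first by exists m, m'; rewrite eq_sym.
  exists m', m; rewrite setUC; split=> //; apply: contraNT m'm => bm; apply/eqP.
  exact: (lone_miss N F fbp).
have : m' \in cell f g None (Some false) by rewrite cm !inE eqxx orbT.
have : m \in cell f g None (Some false) by rewrite cm !inE eqxx.
rewrite !inE => /andP[/eqP fm /eqP gm] /andP[/eqP fm' /eqP gm'].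
have mu : m != u by apply: contra_eqN gm => /eqP ->; rewrite gu.
have m'u : m' != u by apply: contra_eqN gm' => /eqP ->; rewrite gu.
have inM z : f z = None -> [|| z == u, z == a, z == h, z == m | z == m'].
  move=> fz; case gz: (g z) => [[]|].
  - have : z \in [set a; h] by rewrite -gah inE gz.
    by rewrite !inE => /orP[] ->; rewrite !orbT.
  - have : z \in [set m; m'] by rewrite -cm inE fz gz.
    by rewrite !inE => /orP[] ->; rewrite !orbT.
  case: (eqVneq z u) => zu; rewrite ?orbT //.
  by have := ncell_gt1 fz gz fu gu zu; rewrite e2.
have bh : adj b h by rewrite adjC.
have [k [ck kp km]] : exists k, [/\ cut5 k, k p = None & k m = None].
  apply: (lone_cut N Np fm mu) => z fz zu zm; have := inM z fz.
  rewrite (negbTE zu) (negbTE zm) orFb /= => /or3P[]/eqP ->; [by right | by left | by left].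
have [sk k5 k2] := ck; have au : adj a u by rewrite adjC.
have sideP x y (e : bool) : adj x y -> k x = Some e -> k y <> None -> k y = Some e.
  move=> xy kx; have := sk x y e xy kx.
  by case: (k y) => [[]|]; case: (e).
case kb: (k b) => [e|]; last first.
  have [n1 nt nf] := lone_split F fbp Np ck kp kb fm km.
  have kN z : f z = None -> z != m -> k z <> None.
    by move=> fz zm kz; have := ncell_gt1 fz kz fm km zm; rewrite n1.
  have um : u != m by rewrite eq_sym.
  have am : a != m by apply: contra_eqN ga => /eqP ->; rewrite gm.
  have hm : h != m by apply: contra_eqN inh => /eqP ->; rewrite gm.
  case ku: (k u) => [e|]; last exact: kN fu um ku.
  have ka := sideP _ _ _ ua ku (kN a fa am).
  have ah : adj a h by rewrite adjC.
  have kh := sideP _ _ _ ah ka (kN h fh hm).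
  have uh0 : u != h by rewrite eq_sym. have ah0 : a != h by rewrite eq_sym.
  have := ncell_gt2 fu ku fa ka fh kh (adj_neq ua) uh0 ah0.
  by case: (e); rewrite ?nt ?nf.
have [z [fz zu bz kz]] := lone_opp F fbp Np ck kp kb.
have za : z = a.
  have := inM z fz; rewrite (negbTE zu) orFb => /or4P[]/eqP E; rewrite E // in bz kz.
  - by rewrite bh in bz.
  - by rewrite km in kz.
  - by rewrite bm' in bz.
rewrite {z fz zu}za in bz kz.
have both z : adj b z -> adj a z -> k z = None.
  move=> bz' az; case kz0: (k z) => [e'|] //.
  have kze : k z = Some e by apply: sideP bz' kb _; rewrite kz0.
  have := sideP _ _ _ az kz; rewrite kze => /(_ _)[] //.
  by case: (e).
have ku : k u = None by apply: both; rewrite adjC.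
have kh : k h = None by apply: both; rewrite // adjC.
have ab : ~~ adj a b by rewrite adjC.
have Na := pair_nbrs_deg (deg_nbr_of4 cG du ua) cg gah gb ab.
have nbr_b z : adj b z -> k z = Some e -> z = m'.
  move=> bz' kz0; case: (pair_sub cf fbp bz') => [E|fz]; first by rewrite E kp in kz0.
  have := inM z fz; case/or4P=> [/eqP E|/eqP E|/eqP E|/orP[]/eqP E] //; rewrite E in kz0 bz'.
  - by rewrite ku in kz0.
  - by rewrite bz' in bz.
  - by rewrite kh in kz0.
  - by rewrite km in kz0.
have nbr_p z : adj p z -> k z = Some e -> z = b \/ z = m'.
  rewrite Np => /orP[/eqP|/andP[/eqP fz zu]] kz0; first by left.
  right; have := inM z fz; case/or4P=> [/eqP E|/eqP E|/eqP E|/orP[]/eqP E] //; rewrite E in kz0.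
  - by rewrite ku in kz0.
  - by move: kz0; rewrite kz => -[]; case: (e).
  - by rewrite kh in kz0.
  - by rewrite km in kz0.
have nbr_h z : adj h z -> k z = Some e -> z = b.
  rewrite Nh => /orP[/eqP E|/andP[/eqP gz zu]] kz0.
    by move: kz0; rewrite E kz => -[]; case: (e).
  apply/eqP; apply: contraTT isT => zb; have az : adj a z by rewrite Na gz eqxx zb orbT.
  have := sk z a e; rewrite adjC => /(_ az kz0); by rewrite kz.
(* On the side of [b], the cut vertices [p] and [h] see only [b] and [m']. So any further vertices
   there would be bounded by [D], of size at most 1 + (5 - 2); as [D] contains [u], a boundary of
   size 4 is excluded. *)
pose D := m' |: (part k None :\: [set p; h]).
have ph : p != h by apply: contra_eqN gp => /eqP ->; rewrite inh.
have D4 : #|D| <= 4.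
  rewrite cardsU1 cardsDS ?k5 ?cards2 ?ph; first exact: (leq_add (leq_b1 _) (leqnn 3)).
  by apply/subsetP => z; rewrite !inE => /orP[]/eqP ->; rewrite ?kp ?kh.
have uD : u \in D.
  rewrite !inE ku eqxx andbT negb_or (eq_sym u h) hu andbT (eq_sym u p).
  apply/orP; right; apply: contra_eqN inp => /eqP ->; by rewrite fu.
have cover z : k z = Some e -> z \in [set b; m'].
  move=> kz0; apply: contraTT isT => zbm.
  pose C := part k (Some e) :\: [set b; m'].
  suff : 5 <= #|D| by rewrite leqNgt ltnS D4.
  apply: (@bounds5 _ cG C D z).
  - move=> x y xC xy; have := xC; rewrite !inE negb_or -andbA => /and3P[xb xm' /eqP kx].
    have := sk x y e xy kx; case: (eqVneq y m') => ym'; first by rewrite orbT.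
    rewrite orbF orFb; case ky: (k y) => [e'|].
      move=> ee'; have -> : Some e' == Some e by case: (e) ee'; case: (e').
      apply/orP; left; rewrite andbT; apply/eqP => yb; rewrite yb adjC in xy.
      by have E := nbr_b x xy kx; rewrite E eqxx in xm'.
    move=> _; apply/orP; right; rewrite andbT negb_or; apply/andP; split; apply/eqP => E; rewrite E adjC in xy.
      case: (nbr_p x xy kx) => E'; first by rewrite E' eqxx in xb.
      by rewrite E' eqxx in xm'.
    by rewrite (nbr_h x xy kx) eqxx in xb.
  - by rewrite inE zbm inE kz0 eqxx.
  - apply: leq_trans (_ : #|[set p; h]| <= _); first by rewrite cards2 ph.
    have pm' : p != m' by apply: contra_eqN inp => /eqP ->; rewrite fm'.
    have hm' : h != m' by apply: contra_eqN inh => /eqP ->; rewrite gm'.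
    apply/subset_leq_card/subsetP => x; rewrite in_set2 => /orP[]/eqP ->.
      by rewrite !inE (negbTE pm') kp eqxx /= !andbF.
    by rewrite !inE (negbTE hm') kh eqxx orbT /= !andbF.
  - move=> v Cv dv; exists u => //; rewrite adjC; apply: contraTN dv => uv.
    by rewrite -ltnNge; exact: deg_nbr_of4 cG _ _ du uv.
have km' : k m' = Some e.
  have : part k (Some e) \subset [set b; m'].
    by apply/subsetP => z; rewrite inE => /eqP /cover.
  have := k2 e => c2 /subset_leq_card; rewrite cards2 => c2'.
  have bin : b \in part k (Some e) by rewrite inE kb.
  have [|y yb yE] := cards2_other bin.
    by apply/eqP; rewrite eqn_leq c2 andbT (leq_trans c2') //; case: (_ != _).
  have : y \in part k (Some e) by rewrite yE !inE eqxx orbT.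
  by rewrite inE => /eqP ky; have := cover y ky; rewrite !inE (negbTE yb) => /eqP <-.
have um' : ~~ adj u m'.
  rewrite H !inE !negb_or; apply/and4P; split; apply/eqP => E; rewrite -?E in ga fb fc fd.
  - by rewrite gm' in ga.
  - by rewrite fm' in fb.
  - by rewrite fm' in fc.
  - by rewrite fm' in fd.
have hm' : ~~ adj h m'.
  rewrite Nh gm' /= orbF; apply: contra_eqN gm' => /eqP ->; by rewrite ga.
have : degree m' <= #|b |: (part k None :\: [set u; h])|.
  apply/subset_leq_card/subsetP => z; rewrite !inE negb_or => mz.
  have := sk m' z e mz km'; case kz0: (k z) => [e'|].
    move=> ee'; have ze : k z = Some e by rewrite kz0; case: (e) ee'; case: (e').
    have := cover z ze; rewrite !inE => /orP[->//|/eqP E].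
    by rewrite E adjxx in mz.
  move=> _; rewrite eqxx andbT; apply/orP; right; apply/andP; split; apply: contraTneq mz => ->.
    by rewrite adjC.
  by rewrite adjC.
have d5 := lone_deg N bm' m'u.
rewrite cardsU1 cardsDS ?k5 ?cards2 ?[u == h]eq_sym ?hu; last first.
  by apply/subsetP => z; rewrite !inE => /orP[]/eqP ->; rewrite ?ku ?kh.
by move=> /(leq_trans d5); case: (b \notin _).
Qed.

End LoneNeighbour.

(** * Two cuts through complementary pairs of neighbours *)

Definition agree (s t : option bool) :=
  if (s, t) is (Some b, Some c) then b == c else true.

(** The final check for the nine-vertex graph of [cut2_opp]: the variables are the labels of the
    seven vertices other than [w] and [a], and the constraints are edges among them. No labelling
    that respects these edges has two vertices on each side. *)
Lemma no_small_split (b c d x y z u : option bool) :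
  [&& agree x c, agree x d, agree x z, agree y b, agree y c, agree y d & agree y z] ->
  [&& agree z b, agree z c, agree u b, agree u c & agree u d] ->
  2 <= count (pred1 (Some true)) [:: b; c; d; x; y; z; u] ->
  2 <= count (pred1 (Some false)) [:: b; c; d; x; y; z; u] -> False.
Proof.
by case: x => [[]|]; case: y => [[]|]; case: u => [[]|]; case: z => [[]|] //=;
  case: b => [[]|] //=; case: c => [[]|] //=; case: d => [[]|].
Qed.

Section OppositeCuts.
Variable G : sgraph.
Implicit Types (f g : G -> option bool) (C D K E : {set G}).
Hypothesis cG : critical G.
Variable u : G.
Hypothesis du : degree u <= 4.

Notation nbs := (nbs u).
Notation cut1 := (cut1 u).
Notation cut2 := (cut2 u).

(** If [v] had degree 4, it would miss the three neighbours of [u] among its five candidates and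
    keep at most two. So its degree is at least 5 and all candidates are neighbours. *)
Lemma nbrs_full v t1 t2 t3 s1 s2 : u != v ->
  (forall t, adj v t -> t \in [:: t1; t2; t3; s1; s2]) ->
  adj u t1 -> adj u t2 -> adj u t3 ->
  [/\ adj v t1, adj v t2, adj v t3, adj v s1 & adj v s2].
Proof.
move=> uv sub u1 u2 u3.
have degree_le (S : seq G) : (forall t, adj v t -> t \in S) -> degree v <= size S.
  move=> H; apply: leq_trans (card_size S); apply/subset_leq_card/subsetP => t.
  by rewrite inE => /H.
have d5 : 5 <= degree v.
  rewrite ltnNge; apply/negP => dv; have [_ far_v] := far cG uv du dv.
  have : degree v <= 2.
    apply: (degree_le [:: s1; s2]) => t vt; have := sub t vt; rewrite !inE.
    by case/or4P=> [/eqP E|/eqP E|/eqP E|//]; move: vt; rewrite E (negbTE (far_v _ _)).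
  by move=> /(leq_trans (deg_ge4 cG v)).
have all_adj t : t \in [:: t1; t2; t3; s1; s2] -> adj v t.
  move=> tS; apply: contraTT d5 => vt; rewrite -ltnNge ltnS.
  have := degree_le (rem t [:: t1; t2; t3; s1; s2]); rewrite size_rem //; apply.
  move=> t' vt'; have := sub t' vt'; rewrite (perm_mem (perm_to_rem tS)) inE.
  by case/orP=> // /eqP E; rewrite -E vt' in vt.
by split; apply: all_adj; rewrite !inE eqxx ?orbT.
Qed.

(** No corner contains a neighbour of [u], so all nonempty corners have walls of at least 6, and
    counting empties all four. The graph then consists of the two cuts, nine vertices in all, and
    the adjacencies of [x], [y], [z], [w] are forced. There is no 5-cut through the edge [w a]. *)
Lemma cut2_opp f g a b c d : nbs a b c d -> cut2 f a b c d -> cut2 g c d a b -> False.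
Proof.
move=> N [cf fu fa fb [fc fd]] [cg gu gc gd [ga gb]].
have [[U H] [ua ub uc ud]] := (N, nbs_adj N).
have [sf f5 f2] := cf; have [sg g5 g2] := cg.
have free (s t : bool) : 0 < ncell f g (Some s) (Some t) -> 6 <= #|wall f g s t|.
  have no z : adj u z -> f z = Some s -> g z <> Some t.
    rewrite H !inE => /or4P[]/eqP -> fz; first by rewrite fa in fz.
    - by rewrite fb in fz.
    - by rewrite gc.
    by rewrite gd.
  case: t no => no; [apply: corner_u6 (ua) _ | apply: corner_u6 (ub) _] => //.
    by rewrite !inE fa ga !eqxx !orbT.
  by rewrite !inE fb gb !eqxx !orbT.
have f11 := free true true; have f10 := free true false.
have f01 := free false true; have f00 := free false false; clear free.
have m1 := ncell_gt0 fu gu; have m2 := ncell_gt0 fa ga; have m3 := ncell_gt0 fb gb.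
have m4 := ncell_gt0 fc gc; have m5 := ncell_gt0 fd gd.
have r0 := ncell_row f g None; have r1 := ncell_row f g (Some true).
have r2 := ncell_row f g (Some false).
have k0 := ncell_col f g None; have k1 := ncell_col f g (Some true).
have k2 := ncell_col f g (Some false).
have x1 := f2 true; have x2 := f2 false; have x3 := g2 true; have x4 := g2 false.
rewrite !card_wall in f11 f10 f01 f00; rewrite f5 in r0; rewrite g5 in k0.
have [e1 [e2 e3 e4 e5] [e6 e7 e8 e9]] : [/\ ncell f g None None = 1,
   [/\ ncell f g None (Some true) = 2, ncell f g None (Some false) = 2,
       ncell f g (Some true) None = 2 & ncell f g (Some false) None = 2] &
   [/\ ncell f g (Some true) (Some true) = 0, ncell f g (Some true) (Some false) = 0,
       ncell f g (Some false) (Some true) = 0 & ncell f g (Some false) (Some false) = 0]].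
  clear - f11 f10 f01 f00 m1 m2 m3 m4 m5 r0 r1 r2 k0 k1 k2 x1 x2 x3 x4.
  by split; [lia | split; lia | split; lia].
clear f11 f10 f01 f00 m1 m2 m3 m4 m5 r0 r1 r2 k0 k1 k2 x1 x2 x3 x4.
have other t s s' : f t = s -> g t = s' -> ncell f g s s' = 2 ->
    exists x, [/\ cell f g s s' = [set t; x], f x = s, g x = s' & x != t].
  move=> ft gt n2; have tin : t \in cell f g s s' by rewrite inE ft gt !eqxx.
  have [x xt cx] := cards2_other tin n2; exists x.
  have : x \in cell f g s s' by rewrite cx !inE eqxx orbT.
  by rewrite inE => /andP[/eqP fx /eqP gx].
have [x [cx fx gx xa]] := other a _ _ fa ga e2.
have [y [cy fy gy yb]] := other b _ _ fb gb e3.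
have [z [cz fz gz zc]] := other c _ _ fc gc e4.
have [w [cw fw gw wd]] := other d _ _ fd gd e5.
have all9 t : [|| t == u, t == a, t == x, t == b | [|| t == y, t == c, t == z, t == d | t == w]].
  case ft: (f t) => [[]|]; case gt: (g t) => [[]|].
  - by have := ncell_gt0 ft gt; rewrite e6.
  - by have := ncell_gt0 ft gt; rewrite e7.
  - have : t \in [set c; z] by rewrite -cz inE ft gt.
    by rewrite !inE => /orP[] ->; rewrite ?orbT.
  - by have := ncell_gt0 ft gt; rewrite e8.
  - by have := ncell_gt0 ft gt; rewrite e9.
  - have : t \in [set d; w] by rewrite -cw inE ft gt.
    by rewrite !inE => /orP[] ->; rewrite ?orbT.
  - have : t \in [set a; x] by rewrite -cx inE ft gt.
    by rewrite !inE => /orP[] ->; rewrite ?orbT.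
  - have : t \in [set b; y] by rewrite -cy inE ft gt.
    by rewrite !inE => /orP[] ->; rewrite ?orbT.
  case: (eqVneq t u) => // tu.
  by have := ncell_gt1 ft gt fu gu tu; rewrite e1.
have neqf v v' s s' : f v = s -> f v' = s' -> s != s' -> v != v'.
  by move=> <- <-; apply: contraNneq => ->.
have neqg v v' s s' : g v = s -> g v' = s' -> s != s' -> v != v'.
  by move=> <- <-; apply: contraNneq => ->.
have nu v : f v != g v -> [&& v != a, v != b, v != c & v != d] -> ~~ adj u v.
  by move=> _; rewrite H !inE !negb_or.
have ux : ~~ adj u x.
  apply: nu; first by rewrite fx gx.
  by rewrite xa (neqg _ _ _ _ gx gb) // (neqf _ _ _ _ fx fc) // (neqf _ _ _ _ fx fd).
have uy : ~~ adj u y.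
  apply: nu; first by rewrite fy gy.
  by rewrite yb (neqg _ _ _ _ gy ga) // (neqf _ _ _ _ fy fc) // (neqf _ _ _ _ fy fd).
have uz : ~~ adj u z.
  apply: nu; first by rewrite fz gz.
  by rewrite zc (neqf _ _ _ _ fz fa) // (neqf _ _ _ _ fz fb) // (neqf _ _ _ _ fz fd).
have uw : ~~ adj u w.
  apply: nu; first by rewrite fw gw.
  by rewrite wd (neqf _ _ _ _ fw fa) // (neqf _ _ _ _ fw fb) // (neqf _ _ _ _ fw fc).
have sepf v v' (s : bool) : f v = Some s -> f v' = Some (~~ s) -> ~~ adj v v'.
  by move=> fv fv'; apply/negP => vv; case: (sf v v' s vv fv).
have sepg v v' (s : bool) : g v = Some s -> g v' = Some (~~ s) -> ~~ adj v v'.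
  by move=> gv gv'; apply/negP => vv; case: (sg v v' s vv gv).
have [xa' xc xd xz xw] : [/\ adj x a, adj x c, adj x d, adj x z & adj x w].
  apply: nbrs_full => //; first exact: (neqg _ _ _ _ gu gx).
  move=> t; case/or4P: (all9 t) => [/eqP->|/eqP->|/eqP->|/orP[/eqP->|]]; rewrite ?inE ?eqxx ?orbT //.
  - by rewrite adjC (negbTE ux).
  - by rewrite adjxx.
  - by rewrite (negbTE (sepg _ _ true gx gb)).
  case/or4P=> [/eqP->|/eqP->|/eqP->|/orP[]/eqP->]; rewrite ?inE ?eqxx ?orbT //.
  by rewrite (negbTE (sepg _ _ true gx gy)).
have [yb' yc yd yz yw] : [/\ adj y b, adj y c, adj y d, adj y z & adj y w].
  apply: nbrs_full => //; first exact: (neqg _ _ _ _ gu gy).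
  move=> t; case/or4P: (all9 t) => [/eqP->|/eqP->|/eqP->|/orP[/eqP->|]]; rewrite ?inE ?eqxx ?orbT //.
  - by rewrite adjC (negbTE uy).
  - by rewrite (negbTE (sepg _ _ false gy ga)).
  - by rewrite (negbTE (sepg _ _ false gy gx)).
  case/or4P=> [/eqP->|/eqP->|/eqP->|/orP[]/eqP->]; rewrite ?inE ?eqxx ?orbT //.
  by rewrite adjxx.
have [zc' za zb zx zy] : [/\ adj z c, adj z a, adj z b, adj z x & adj z y].
  apply: nbrs_full => //; first exact: (neqf _ _ _ _ fu fz).
  move=> t; case/or4P: (all9 t) => [/eqP->|/eqP->|/eqP->|/orP[/eqP->|]]; rewrite ?inE ?eqxx ?orbT //.
  - by rewrite adjC (negbTE uz).
  case/or4P=> [/eqP->|/eqP->|/eqP->|/orP[]/eqP->]; rewrite ?inE ?eqxx ?orbT //.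
  - by rewrite adjxx.
  - by rewrite (negbTE (sepf _ _ true fz fd)).
  - by rewrite (negbTE (sepf _ _ true fz fw)).
have [wd' wa wb wx wy] : [/\ adj w d, adj w a, adj w b, adj w x & adj w y].
  apply: nbrs_full => //; first exact: (neqf _ _ _ _ fu fw).
  move=> t; case/or4P: (all9 t) => [/eqP->|/eqP->|/eqP->|/orP[/eqP->|]]; rewrite ?inE ?eqxx ?orbT //.
  - by rewrite adjC (negbTE uw).
  case/or4P=> [/eqP->|/eqP->|/eqP->|/orP[]/eqP->]; rewrite ?inE ?eqxx ?orbT //.
  - by rewrite (negbTE (sepf _ _ false fw fc)).
  - by rewrite (negbTE (sepf _ _ false fw fz)).
  - by rewrite adjxx.
have [|k [ck kw ka]] := edge_cut cG wa.
  move=> t wt at_; rewrite adjC in at_; case: (eqVneq t u) => [tu|tu].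
    by rewrite tu adjC (negbTE uw) in wt.
  by rewrite adjC in at_; exact: deg_dist2_of4 cG _ _ _ du ua at_ tu.
have [sk k5 k2] := ck.
have ag v v' : adj v v' -> agree (k v) (k v').
  move=> vv; have := sk v v' ^~ vv; rewrite /agree.
  by case: (k v) => [s|] //; case: (k v') => [s'|] // /(_ s erefl); case: s; case: s'.
have cnt (s : bool) : 2 <= count (pred1 (Some s)) [:: k b; k c; k d; k x; k y; k z; k u].
  apply: leq_trans (k2 s) _; rewrite (_ : [:: k b; _; _; _; _; _; _] = map k [:: b; c; d; x; y; z; u]) //.
  rewrite count_map -size_filter; apply: leq_trans (card_size _).
  apply/subset_leq_card/subsetP => t; rewrite inE => kt; rewrite mem_filter /= kt /=.
  case/or4P: (all9 t) => [/eqP E|/eqP E|/eqP E|/orP[/eqP E|]]; rewrite ?inE ?E ?eqxx ?orbT //.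
    by rewrite E ka in kt.
  case/or4P=> [/eqP E|/eqP E|/eqP E|/orP[]/eqP E]; rewrite ?inE ?E ?eqxx ?orbT //.
  by rewrite E kw in kt.
by apply: (@no_small_split (k b) (k c) (k d) (k x) (k y) (k z) (k u)); rewrite ?ag //;
  exact: cnt.
Qed.

(** * The last configuration around the vertex of degree 4 *)

Section LastConfiguration.
Variables (f g : G -> option bool) (a b c d p : G).
Hypotheses (N : nbs a b c d) (F : cut1 f a b c d) (Gb : cut2 g b c a d).
Hypotheses (fbp : part f (Some true) = [set b; p]) (gp : g p = None) (pb : p != b).
Hypothesis ga3 : 3 <= #|part g (Some true)|.

Section Cross.
Variable k : G -> option bool.
Hypotheses (ck : cut5 k) (kb : k b = None) (kp : k p = None) (ku : k u = Some true).

Lemma pair_wall (s t : bool) : [set b; p] \subset wall g k s t.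
Proof.
have [_ _ gb _ _] := Gb.
by apply/subsetP => z; rewrite !inE => /orP[]/eqP ->; rewrite ?gb ?gp ?kb ?kp !eqxx ?orbT.
Qed.

Lemma pair_corner_nonadj (s t : bool) E :
  (forall z, g z = Some s -> k z = Some t -> f z = None -> z \in E) ->
  forall r z, r \in [set b; p] -> g z = Some s -> k z = Some t -> z \notin E -> ~~ adj r z.
Proof.
have [[sf _ _] _ _ _ _] := F; have [_ _ gb _ _] := Gb.
move=> TE r z rK gz kz zE; apply/negP => rz.
have fr : f r = Some true by apply/eqP; move: rK; rewrite -fbp inE.
have := sf r z true rz fr; case fz: (f z) => [[]|] //= _; last by rewrite (TE z gz kz fz) in zE.
have : z \in [set b; p] by rewrite -fbp inE fz.
by rewrite !inE => /orP[]/eqP E0; rewrite E0 ?gb ?gp in gz.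
Qed.

(** Outside the pair, [b] and [p] see only vertices of the cut [f]. Once those in the corner are
    moved to [E], both drop out of the wall, which raises 5 to 7; [v] keeps the corner from being a
    vertex of degree 4. *)
Lemma cross_corner (s t : bool) E v : E \subset cell g k (Some s) (Some t) ->
  (forall z, g z = Some s -> k z = Some t -> f z = None -> z \in E) ->
  v \in wall g k s t -> v \notin [set b; p] -> (v == u) || adj u v ->
  #|E| < ncell g k (Some s) (Some t) -> 7 <= #|wall g k s t| + #|E|.
Proof.
have [cg gu gb _ _] := Gb; have [sk _ _] := ck.
move=> sE TE vw vK uv lt.
have := corner_far cG du (d := v) cg sk gu (pair_wall s t) sE (pair_corner_nonadj TE).
rewrite cards2 [b == p]eq_sym pb; apply=> //.
by rewrite in_setU in_setD vK vw.
Qed.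

(** No wall vertex near [u] is supplied here, so the starting point is the bound 4 for nonempty
    corners. *)
Lemma cross_corner0 (s t : bool) :
  (forall z, g z = Some s -> k z = Some t -> f z <> None) ->
  0 < ncell g k (Some s) (Some t) -> 6 <= #|wall g k s t|.
Proof.
have [cg gu gb _ _] := Gb; have [sk _ _] := ck.
move=> TE lt; have := @corner4 _ cG g k s t [set b; p] set0 cg sk (pair_wall s t) (sub0set _).
rewrite cards2 [b == p]eq_sym pb cards0 addn0; apply=> //.
by apply: pair_corner_nonadj => z gz kz fz; case: (TE z gz kz fz).
Qed.

Lemma cross_deg5 (s t : bool) v : g v = Some s -> k v = Some t -> 5 <= degree v ->
  5 <= #|wall g k s t|.
Proof.
have [cg _ _ _ _] := Gb; have [sk _ _] := ck.
move=> gv kv dv; have := @corner5 _ cG g k s t set0 set0 cg sk (sub0set _) (sub0set _).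
rewrite !cards0 !addn0; apply.
- by move=> r z; rewrite inE.
- exact: ncell_gt0 gv kv.
move=> w Cw dw; have : v \in [set w] by rewrite -Cw !inE gv kv !eqxx.
by rewrite inE => /eqP E; move: dv; rewrite E leqNgt ltnS dw.
Qed.

(** The alternatives come from [c] and [d]: both are adjacent to [u], so [k] contains them or puts
    them on the side of [u]. *)
Lemma cross_cards : [/\ ncell g k None None + ncell g k None (Some true) + ncell g k None (Some false) = 5,
  ncell g k None None + ncell g k (Some true) None + ncell g k (Some false) None = 5,
  2 <= ncell g k None None, 1 <= ncell g k None (Some true) &
  [/\ 2 <= ncell g k None (Some true) \/ 3 <= ncell g k None None,
      1 <= ncell g k (Some false) None \/ 1 <= ncell g k (Some false) (Some true) &
      3 <= ncell g k (Some true) None + ncell g k (Some true) (Some true) +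
           ncell g k (Some true) (Some false)]].
Proof.
have [[_ g5 _] gu gb gc [ga gd]] := Gb; have [sk k5 _] := ck.
have [U _] := N; have [ua ub uc ud] := nbs_adj N.
have [_ _ _ fb [fc fd]] := F.
have bp : b != p by rewrite eq_sym.
have cb : c != b by move: U; rewrite /= !inE !negb_or => /and4P[_ /andP[]]; rewrite eq_sym.
have cp : c != p.
  apply: contra_eqN fc => /eqP ->.
  by have /setP/(_ p) := fbp; rewrite !inE eqxx orbT => /eqP ->.
split; [by rewrite -ncell_row g5|by rewrite -ncell_col k5|exact: (ncell_gt1 gb kb gp kp)
       |exact: ncell_gt0 gu ku|split].
- case kc: (k c) => [[]|].
  + by left; exact: (ncell_gt1 gu ku gc kc (adj_neq uc)).
  + by case: (sk u c true uc ku).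
  + by right; apply: (ncell_gt2 gb kb gp kp gc kc bp); rewrite eq_sym.
- case kd: (k d) => [[]|].
  + by right; exact: (ncell_gt0 gd kd).
  + by case: (sk u d true ud ku).
  + by left; exact: (ncell_gt0 gd kd).
by rewrite -ncell_row.
Qed.

End Cross.

Section Cut.
Variables h m m' : G.
Hypothesis inM : forall z, f z = None -> [|| z == u, z == a, z == h, z == m | z == m'].
Hypotheses (gh : g h = Some true) (fm : f m = None) (gm : g m = Some false).
Hypotheses (gm' : g m' = Some false) (mm' : m != m').

Variable k : G -> option bool.
Hypotheses (ck : cut5 k) (kb : k b = None) (kp : k p = None) (ku : k u = Some true).

Lemma u_out : u \notin [set b; p].
Proof.
have [_ fu _ _ _] := F.
by rewrite -fbp inE fu.
Qed.

Lemma u_wall (s : bool) : u \in wall g k s true.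
Proof. by have [_ gu _ _ _] := Gb; rewrite !inE gu ku !eqxx ?orbT. Qed.

Lemma cross_free (s : bool) :
  (forall z, g z = Some s -> k z = Some true -> f z <> None) ->
  0 < ncell g k (Some s) (Some true) -> 7 <= #|wall g k s true|.
Proof.
move=> TE n0; have := @cross_corner k ck kb kp s true set0 u (sub0set _).
rewrite cards0 addn0; apply; rewrite ?eqxx ?u_out ?u_wall //.
by move=> z gz kz fz; case: (TE z gz kz fz).
Qed.

Lemma cross_one (s t : bool) e v : g e = Some s -> k e = Some t ->
  (forall z, g z = Some s -> k z = Some t -> f z = None -> z = e) ->
  v \in wall g k s t -> v \notin [set b; p] -> (v == u) || adj u v ->
  1 < ncell g k (Some s) (Some t) -> 6 <= #|wall g k s t|.
Proof.
move=> ge ke TE vw vK uv n1; have := @cross_corner k ck kb kp s t [set e] v.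
rewrite cards1 addn1; apply=> //; first by rewrite sub1set inE ge ke !eqxx.
by move=> z gz kz fz; rewrite (TE z gz kz fz) inE.
Qed.

Lemma cross_ge5 (s : bool) : 0 < ncell g k (Some s) (Some true) -> 5 <= #|wall g k s true|.
Proof.
have [cg gu _ _ _] := Gb; have [sk _ _] := ck.
move=> n0; have := @corner_far _ cG u du g k s true set0 set0 u cg sk gu (sub0set _) (sub0set _).
rewrite cards0 !addn0; apply=> //; first by move=> r z; rewrite inE.
  by rewrite in_setU in_setD inE u_wall.
by rewrite eqxx.
Qed.

Lemma a_out : a \notin [set b; p].
Proof. by have [_ _ fa _ _] := F; rewrite -fbp inE fa. Qed.

Lemma cross_false2 : k m = Some false -> k m' = Some false -> 5 <= #|wall g k false false|.
Proof.
move=> km km'; have [cg _ _ _ _] := Gb; have [sk _ _] := ck.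
by apply: (corner_nil5 cG cg sk); exact: (ncell_gt1 gm km gm' km' mm').
Qed.

(** The corner away from [a] and on the side of [u] contains no vertex of the cut [f] and would need
    a wall of 7, while the opposite corner contains [h] and needs 5. So it is empty, [d] joins [m]
    in [k], and the wall of the corner of [h] has at most 3 + 1 vertices. *)
Lemma no_cut_m : k m = None -> k m' = Some false -> k a = Some true -> k h = Some false ->
  5 <= degree h -> False.
Proof.
have [cg gu gb gc [ga gd]] := Gb; have [cf fu fa fb [fc fd]] := F.
move=> km km' ka kh dh; have [n1 n2 n3 n4 [n5 n6 n7]] := cross_cards ck kb kp ku.
have mi := ncell_gt0 gm km; have w1 := cross_deg5 ck gh kh dh.
have w2 : 0 < ncell g k (Some false) (Some true) -> 7 <= #|wall g k false true|.
  by apply: cross_free => z gz kz fz; case/or4P: (inM fz) => [/eqP E|/eqP E|/eqP E|/orP[]/eqP E];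
    move: gz kz; rewrite E ?gu ?ga ?gh ?km ?km'.
have md : 2 <= ncell g k (Some false) None \/ 1 <= ncell g k (Some false) (Some true).
  case kd: (k d) => [[]|].
  - by right; exact: ncell_gt0 gd kd.
  - by have [_ _ _ ud] := nbs_adj N; have [sk _ _] := ck; case: (sk u d true ud ku).
  - left; apply: (ncell_gt1 gm km gd kd).
    by apply: contra_eqN fm => /eqP ->; rewrite fd.
rewrite !card_wall in w1 w2; clear - n1 n2 n3 n4 n5 md w1 w2; lia.
Qed.

(** The corner of [y] faces that of [m] and [m'], so its wall has exactly 5 vertices and the corner
    is [y] alone. The two other corners are empty. As the side of [a] in [g] has at least three
    vertices, two of them lie in [k], and [cross_cards] brings the wall at [y] up to 6. *)
Lemma no_cut_ah x y : [&& f x == None, g x == Some true, f y == None & g y == Some true] ->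
  [set x; y] = [set a; h] ->
  k x = None -> k y = Some true -> k m = Some false -> k m' = Some false -> False.
Proof.
move=> /and4P[/eqP fx /eqP gx /eqP fy /eqP gy] xy kx ky km km'.
have [cg gu gb gc [ga gd]] := Gb; have [cf fu fa fb [fc fd]] := F.
have inM' z : f z = None -> [|| z == u, z == x, z == y, z == m | z == m'].
  move=> /inM; have /setP/(_ z) := xy; rewrite !inE => E.
  by case/or4P=> [->|az|hz|->]; rewrite ?orbT //; move: E; rewrite ?az ?hz ?orbT //
    => /orP[] ->; rewrite ?orbT.
have [n1 n2 n3 n4 [n5 n6 n7]] := cross_cards ck kb kp ku.
have mx := ncell_gt0 gx kx; have my := ncell_gt0 gy ky.
have mf := ncell_gt1 gm km gm' km' mm'; have wf := cross_false2 km km'.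
have ft : 0 < ncell g k (Some false) (Some true) -> 7 <= #|wall g k false true|.
  apply: cross_free => z gz kz /inM'.
  by case/or4P=> [/eqP E|/eqP E|/eqP E|/orP[]/eqP E]; move: gz kz;
    rewrite E ?gu ?gx ?gy ?km ?km'.
have tf : 0 < ncell g k (Some true) (Some false) -> 6 <= #|wall g k true false|.
  apply: (cross_corner0 ck kb kp) => z gz kz /inM'.
  by case/or4P=> [/eqP E|/eqP E|/eqP E|/orP[]/eqP E]; move: gz kz;
    rewrite E ?gu ?kx ?ky ?gm ?gm'.
have tt : 1 < ncell g k (Some true) (Some true) -> 6 <= #|wall g k true true|.
  apply: (cross_one gy ky _ (u_wall _) u_out); rewrite ?eqxx // => z gz kz /inM'.
  by case/or4P=> [/eqP E|/eqP E|/eqP E|/orP[]/eqP E] //; move: gz kz;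
    rewrite E ?gu ?kx ?ky ?gm ?gm'.
have tt1 : 5 <= #|wall g k true true|.
  exact: cross_ge5 (ncell_gt0 gy ky).
rewrite !card_wall in wf ft tf tt tt1; clear - n1 n2 n3 n4 n5 n6 n7 mx my mf wf ft tf tt tt1; lia.
Qed.
(** The corner with the sides of [a] and of [u] avoids the cut [f] and faces [m']: it is empty. The
    corners of [h] and [m] face each other, so both walls have 5 vertices and [h] is alone. Hence at
    least two vertices on the side of [a] lie in [k], and too few remain for the wall at [m']. *)
Lemma no_cut_a : k a = None -> k m = Some true -> k h = Some false -> k m' = Some false ->
  5 <= degree h -> 5 <= degree m' -> False.
Proof.
have [cg gu gb gc [ga gd]] := Gb; have [cf fu fa fb [fc fd]] := F.
move=> ka km kh km' dh dm'; have [n1 n2 n3 n4 [n5 n6 n7]] := cross_cards ck kb kp ku.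
have ma := ncell_gt0 ga ka; have mh := ncell_gt0 gh kh.
have ff := cross_deg5 ck gm' km' dm'; have tf := cross_deg5 ck gh kh dh.
have ft := cross_ge5 (ncell_gt0 gm km).
have tt : 0 < ncell g k (Some true) (Some true) -> 7 <= #|wall g k true true|.
  by apply: cross_free => z gz kz fz; case/or4P: (inM fz) => [/eqP E|/eqP E|/eqP E|/orP[]/eqP E];
    move: gz kz; rewrite E ?gu ?ka ?kh ?gm ?km'.
have tf1 : 1 < ncell g k (Some true) (Some false) -> 6 <= #|wall g k true false|.
  apply: (cross_one gh kh _ (v := a)).
  - by move=> z gz kz fz; case/or4P: (inM fz) => [/eqP E|/eqP E|/eqP E|/orP[]/eqP E];
    move: gz kz; rewrite E ?gu ?ka ?kh ?gm ?gm'.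
  - by rewrite !inE ga ka !eqxx.
  - exact: a_out.
  by have [-> _ _ _] := nbs_adj N; rewrite orbT.
rewrite !card_wall in ff tf ft tt tf1.
clear - n1 n2 n3 n4 n5 n6 n7 ma mh ff tf ft tt tf1; lia.
Qed.

End Cut.
End LastConfiguration.

End OppositeCuts.

(** * Excluding the vertex of degree 4 *)

Section DegreeFourEnd.
Variable G : sgraph.
Implicit Types (f g : G -> option bool) (C D K E : {set G}).
Hypothesis cG : critical G.
Variable u : G.
Hypothesis du : degree u <= 4.

Notation nbs := (nbs u).
Notation cut1 := (cut1 u).
Notation cut2 := (cut2 u).

Lemma cut1_cut2 f g a b c d : nbs a b c d -> cut1 f a b c d -> cut2 g b c a d ->
  3 <= #|part g (Some true)| -> False.
Proof.
move=> N F Gb ga3; have [p [fbp pb up Np]] := lone cG du N F.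
have [[U H] [ua ub uc ud]] := (N, nbs_adj N).
have [cf fu fa fb [fc fd]] := F; have [cg gu gb gc [ga gd]] := Gb.
have [_ [e1 e2 e3 e4]] := cut1_cross cG du N F cg gu gb.
have fp : f p = Some true.
  by apply/eqP; have /setP/(_ p) := fbp; rewrite !inE eqxx orbT.
have gp : g p = None.
  by case gp: (g p) => [s|] //; have := ncell_gt0 fp gp; rewrite e3.
have ain : a \in cell f g None (Some true) by rewrite inE fa ga !eqxx.
have [h ha ch] := cards2_other ain (e4 true).
have : h \in cell f g None (Some true) by rewrite ch !inE eqxx orbT.
rewrite inE => /andP[/eqP fh /eqP gh].
have /card_gt0P[m min] : 0 < ncell f g None (Some false) by rewrite e4.
have [m' m'm cm] := cards2_other min (e4 false).
have : m' \in cell f g None (Some false) by rewrite cm !inE eqxx orbT.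
move: min; rewrite !inE => /andP[/eqP fm /eqP gm] /andP[/eqP fm' /eqP gm'].
have mm' : m != m' by rewrite eq_sym.
have inM z : f z = None -> [|| z == u, z == a, z == h, z == m | z == m'].
  move=> fz; case gz: (g z) => [[]|].
  - have : z \in [set a; h] by rewrite -ch inE fz gz.
    by rewrite !inE => /orP[] ->; rewrite !orbT.
  - have : z \in [set m; m'] by rewrite -cm inE fz gz.
    by rewrite !inE => /orP[] ->; rewrite !orbT.
  case: (eqVneq z u) => zu; rewrite ?orbT //.
  by have := ncell_gt1 fz gz fu gu zu; rewrite e2.
have inM' z : f z = None -> [|| z == u, z == a, z == h, z == m' | z == m].
  by move=> /inM; rewrite [(z == m) || _]orbC.
have gneq v v' s s' : g v = s -> g v' = s' -> s != s' -> v != v'.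
  by move=> <- <-; apply: contraNneq => ->.
have hu : h != u by apply: (gneq _ _ _ _ gh gu).
have mu : m != u by apply: (gneq _ _ _ _ gm gu).
have m'u : m' != u by apply: (gneq _ _ _ _ gm' gu).
have am : a != m by apply: (gneq _ _ _ _ ga gm).
have am' : a != m' by apply: (gneq _ _ _ _ ga gm').
have hm : h != m by apply: (gneq _ _ _ _ gh gm).
have hm' : h != m' by apply: (gneq _ _ _ _ gh gm').
(* [x] is the vertex of the cut [f] that [b] misses, or [h] if there is none. With this choice the
   cut through [p] and [x] has to contain [b], since otherwise [lone_opp] gives another missed
   vertex. *)
have [x [fx xu hx]] : exists x, [/\ f x = None, x != u &
    forall z, f z = None -> z != u -> z != x -> adj b z].
  case: (pickP [pred z | (f z == None) && ~~ adj b z]) => [x /andP[/eqP fx bx]|none].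
    exists x; split=> //; first by apply: contraNneq bx => ->; rewrite adjC.
    by move=> z fz zu zx; apply: contraNT zx => bz; apply/eqP; exact: (lone_miss cG du N F fbp).
  exists h; split=> // z fz _ _; have := none z; rewrite /= fz eqxx /=.
  by move/negbFE.
have dx z : f z = None -> z != u -> z != x -> 5 <= degree z.
  by move=> fz zu zx; apply: (lone_deg cG du N (hx z fz zu zx)).
have [k0 [ck0 kp0 kx0]] : exists k, [/\ cut5 k, k p = None & k x = None].
  by apply: (lone_cut cG du N Np fx xu) => z fz zu zx; left; exact: hx.
have kb0 : k0 b = None.
  case kb: (k0 b) => [e|] //.
  have [z [fz zu bz kz]] := lone_opp cG F fbp Np ck0 kp0 kb.
  by rewrite hx // in bz; apply: contra_eqN kz => /eqP ->; rewrite kx0.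
have [n1 _ _] := lone_split cG F fbp Np ck0 kp0 kb0 fx kx0.
have [k [ck kp kx kb ku]] : exists k, [/\ cut5 k, k p = None, k x = None, k b = None &
    k u = Some true].
  case ku: (k0 u) => [[]|]; first by exists k0.
    exists (flip k0); rewrite /flip kp0 kx0 kb0 ku; split=> //; exact: cut5_flip.
  by have := ncell_gt1 fu ku fx kx0; rewrite eq_sym n1 => /(_ xu).
have {k0 ck0 kp0 kx0 kb0 n1} [n1 nt nf] := lone_split cG F fbp Np ck kp kb fx kx.
have [sk _ _] := ck.
have kN z : f z = None -> z != x -> k z <> None.
  by move=> fz zx kz; have := ncell_gt1 fz kz fx kx zx; rewrite n1.
have kF z : f z = None -> z != x -> k z <> Some true -> k z = Some false.
  by move=> fz zx; have := kN z fz zx; case: (k z) => [[]|].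
have kT z : f z = None -> z != x -> adj u z -> k z = Some true.
  by move=> fz zx uz; have := sk u z true uz ku; have := kN z fz zx; case: (k z) => [[]|].
have ux : u != x by rewrite eq_sym.
have two y z : f y = None -> f z = None -> y != u -> z != u -> y != z ->
    k y = Some true -> k z <> Some true.
  move=> fy fz yu zu yz ky kz.
  by have := ncell_gt2 fu ku fy ky fz kz; rewrite ![u == _]eq_sym nt => /(_ yu zu yz).
have au : a != u by rewrite eq_sym adj_neq.
(* The four vertices of the cut [f] other than [x] are split two and two by [k]. If [x] is not [a],
   then [a] accompanies its neighbour [u] and the labels of the rest follow; if [x] is [a], the
   companion of [u] is [h], [m] or [m']. *)
have := inM x fx; rewrite (negbTE xu) orFb => /or4P[]/eqP xE; rewrite xE in kx hx dx kN kF kT.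
- have hdeg := dx h fh hu ha.
  have ma : m != a by rewrite eq_sym. have m'a : m' != a by rewrite eq_sym.
  case kh: (k h) => [[]|]; last by case: (kN h fh ha).
    have km := kF m fm ma (two h m fh fm hu mu hm kh).
    have km' := kF m' fm' m'a (two h m' fh fm' hu m'u hm' kh).
    apply: (no_cut_ah cG du N F Gb fbp gp pb ga3 inM gm gm' mm' ck kb kp ku (x := a) (y := h)) => //.
    by rewrite fa ga fh gh.
  case km: (k m) => [[]|]; last by case: (kN m fm ma).
    have km' := kF m' fm' m'a (two m m' fm fm' mu m'u mm' km).
    exact: (no_cut_a cG du N F Gb fbp gp pb ga3 inM gh gm gm' ck kb kp ku kx km kh km' hdeg
      (dx m' fm' m'u m'a)).
  case km': (k m') => [[]|]; last by case: (kN m' fm' m'a).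
    exact: (no_cut_a cG du N F Gb fbp gp pb ga3 inM' gh gm' gm ck kb kp ku kx km' kh km hdeg
      (dx m fm mu ma)).
  by have := ncell_gt2 fh kh fm km fm' km' hm hm' mm'; rewrite nf.
- have ah : a != h by rewrite eq_sym. have mh : m != h by rewrite eq_sym.
  have m'h : m' != h by rewrite eq_sym.
  have ka := kT a fa ah ua.
  have km := kF m fm mh (two a m fa fm au mu am ka).
  have km' := kF m' fm' m'h (two a m' fa fm' au m'u am' ka).
  apply: (no_cut_ah cG du N F Gb fbp gp pb ga3 inM gm gm' mm' ck kb kp ku (x := h) (y := a)) => //.
    by rewrite fa ga fh gh.
  by rewrite setUC.
- have ka := kT a fa am ua; have ah : a != h by rewrite eq_sym.
  have kh := kF h fh hm (two a h fa fh au hu ah ka).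
  have km' := kF m' fm' m'm (two a m' fa fm' au m'u am' ka).
  exact: (no_cut_m cG du N F Gb fbp gp pb ga3 inM gh fm gm ck kb kp ku kx km' ka kh
    (dx h fh hu hm)).
- have ka := kT a fa am' ua; have ah : a != h by rewrite eq_sym.
  have kh := kF h fh hm' (two a h fa fh au hu ah ka).
  have km := kF m fm mm' (two a m fa fm au mu am ka).
  exact: (no_cut_m cG du N F Gb fbp gp pb ga3 inM' gh fm' gm' ck kb kp ku kx km ka kh
    (dx h fh hu hm')).
Qed.

Ltac perm_nbs N := by apply: (nbs_perm N); apply/permP => P /=; lia.

Lemma cut1_sym f a b c d : cut1 f a b c d -> cut1 f a b d c.
Proof. by case=> ? ? ? ? []. Qed.

(** By [lone], the side of [c] in [g] has two vertices; crossing with [f] puts two vertices of the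
    cut [f] there, in addition to [c]. *)
Lemma cut1_shift f g a b c d : nbs a b c d -> cut1 f a b c d -> cut1 g b c a d -> False.
Proof.
move=> N F Gb; have N' : nbs b c a d by perm_nbs N.
have [cf fu fa fb [fc fd]] := F; have [cg gu gb gc [ga gd]] := Gb.
have [_ [_ _ _ e4]] := cut1_cross cG du N F cg gu gb.
have [p [gcp _ _ _]] := lone cG du N' Gb.
have := ncell_col f g (Some true); have := ncell_gt0 fc gc; have := e4 true; rewrite gcp.
have := leq_b1 (c != p); rewrite cards2; clear; case: (c != p); lia.
Qed.

(** A cut through [u] and [b] cannot contain [a], nor leave [a], [c] or [d] alone; so it contains
    [c] or [d] and separates the other one from [a]. *)
Lemma cut1_next f a b c d : nbs a b c d -> cut1 f a b c d ->
  exists g, cut2 g b c a d \/ cut2 g b d a c.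
Proof.
move=> N F; have [ua ub uc ud] := nbs_adj N.
have N' : nbs b a c d by perm_nbs N. have N2 : nbs a b d c by perm_nbs N.
have [k [ck ku kb]] := cut_at cG du ub.
have [ga0 _] := cut1_cross cG du N F ck ku kb.
have [g] := cut_types cG N' ck ku kb.
case=> [K|[K|[K|[K|[K|K]]]]].
- by case: (cut1_swap cG du N F K).
- by case: (cut1_shift N F K).
- by case: (cut1_shift N2 (cut1_sym F) K).
- have [cg gu gb ga _] := K.
  by have [] := cut1_cross cG du N F cg gu gb.
- by exists g; left.
by exists g; right.
Qed.

(** A cut through [u] and [c] containing a second neighbour of [u] is excluded: by [cut2_pair] if
    this is [a] or [b], by [cut2_opp] if it is [d]. *)
Lemma cut2_next f a b c d : nbs a b c d -> cut2 f a b c d ->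
  exists g, cut1 g c a b d \/ cut1 g c b a d \/ cut1 g c d a b.
Proof.
move=> N F; have [ua ub uc ud] := nbs_adj N.
have N' : nbs c a b d by perm_nbs N. have N2 : nbs b a c d by perm_nbs N.
have [k [ck ku kc]] := cut_at cG du uc.
have [g] := cut_types cG N' ck ku kc.
case=> [K|[K|[K|[K|[K|K]]]]]; [by exists g; left | by exists g; right; left
  | by exists g; right; right | | |].
- by case: (cut2_pair cG du N F (cut2_swap K)).
- by case: (cut2_pair cG du N2 (cut2_swap F) (cut2_swap K)).
- by case: (cut2_opp cG du N F K).
Qed.

Lemma no_degree4 : False.
Proof.
have [a [b [c [d N]]]] := nbs_ex cG du.
have [a' [b' [c' [d' [f [N' F]]]]]] : exists a b c d f, nbs a b c d /\ cut1 f a b c d.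
  have [ua ub uc ud] := nbs_adj N; have [k [ck ku ka]] := cut_at cG du ua.
  have c2 w x y z f : nbs w x y z -> cut2 f w x y z ->
      exists a b c d f, nbs a b c d /\ cut1 f a b c d.
    move=> M K; have [g [L|[L|L]]] := cut2_next M K.
    - by exists y, w, x, z, g; split=> //; perm_nbs M.
    - by exists y, x, w, z, g; split=> //; perm_nbs M.
    - by exists y, z, w, x, g; split=> //; perm_nbs M.
  have [g] := cut_types cG N ck ku ka.
  case=> [K|[K|[K|[K|[K|K]]]]].
  - by exists a, b, c, d, g.
  - by exists a, c, b, d, g; split=> //; perm_nbs N.
  - by exists a, d, b, c, g; split=> //; perm_nbs N.
  - exact: (c2 _ _ _ _ g N K).
  - by apply: (c2 a c b d g) => //; perm_nbs N.
  - by apply: (c2 a d b c g) => //; perm_nbs N.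
clear a b c d N.
(* The next cut, through [u] and [d], leaves one of [b], [c], [a] alone. For [b] or [c], crossing it
   with [g] gives two vertices besides [a] on the side of [a], as [cut1_cut2] requires. For [a],
   [cut1_next] leads to a cut that [cut2_pair] excludes next to [g]. *)
have main a b c d f0 g : nbs a b c d -> cut1 f0 a b c d -> cut2 g b c a d -> False.
  move=> N F0 Gb; have M : nbs b c d a by perm_nbs N.
  have [cg gu gb gc [ga gd]] := Gb.
  have big k x y z : nbs d x y z -> cut1 k d x y z -> g x = None -> k a = Some false -> False.
    move=> Mx K gx ka; have [_ [_ _ _ e4]] := cut1_cross cG du Mx K cg gu gx.
    apply: (cut1_cut2 N F0 Gb); have := ncell_col k g (Some true); have := e4 true.
    have := ncell_gt0 ka ga; clear; lia.
  have [k [K|[K|K]]] := cut2_next M (cut2_flip Gb).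
  - have [_ _ _ _ [_ ka]] := K; apply: (big k b c a) => //; perm_nbs N.
  - have [_ _ _ _ [_ ka]] := K; apply: (big k c b a) => //; perm_nbs N.
  have Md : nbs d a b c by perm_nbs N.
  have [l [L|L]] := cut1_next Md K.
    have Nb : nbs b a c d by perm_nbs N.
    exact: (cut2_pair cG du Nb (cut2_flip (cut2_swap L)) Gb).
  have Nc : nbs c a b d by perm_nbs N.
  exact: (cut2_pair cG du Nc (cut2_flip (cut2_swap L)) (cut2_swap Gb)).
have [g [Gb|Gb]] := cut1_next N' F; first exact: main N' F Gb.
have N2 : nbs a' b' d' c' by perm_nbs N'.
exact: (main _ _ _ _ _ _ N2 (cut1_sym F) Gb).
Qed.

End DegreeFourEnd.

Lemma not_critical (G : sgraph) (v : G) : ~ critical G.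
Proof.
move=> cG; case: (boolP [forall v : G, 5 <= degree v]) => [/forallP d5|].
  have /card_gt0P[w] : 0 < #|[set w | adj v w]| by apply: leq_trans (deg_ge4 cG v).
  rewrite inE => vw; have [f [cf _ _]] := edge_cut_deg5 cG d5 vw.
  by apply: (critical_deg5 cG d5); exists f.
rewrite negb_forall => /existsP[u]; rewrite -leqNgt => du.
exact: (no_degree4 cG du).
Qed.

(** * Cuts in a graph and in a contraction *)

Section Cuts.
Variable G : sgraph.
Implicit Types (f g : G -> option bool) (C D S : {set G}).

Lemma del_adj_sym S : symmetric (@del_adj G S).
Proof. by move=> x y; rewrite /del_adj adjC andbCA. Qed.

Lemma connect_in C D x y : bounds D C -> connect (del_adj (D :\: C)) x y ->
  x \in C -> y \in C.
Proof.
move=> bD /connectP[p]; elim: p x => [|z p IH] x /=; first by move=> _ ->.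
move=> /andP[/and3P[_ zS xz] zp] yl xC; apply: IH zp yl _.
by have := bD x z xC xz; move: zS; rewrite !inE; case: (z \in C) => //= /negbTE ->.
Qed.

Lemma is_cut_bounds C D : bounds D C -> 0 < #|C| -> 0 < #|~: (C :|: D)| ->
  is_cut (D :\: C).
Proof.
move=> bD /card_gt0P[x xC] /card_gt0P[y]; rewrite !inE negb_or => /andP[yC yD].
apply/existsP; exists x; rewrite !inE xC /=; apply/existsP; exists y.
rewrite !inE negb_and negbK yD orbT /=; apply: contra yC => xy.
exact: connect_in bD xy xC.
Qed.

Definition class S x := [set y in ~: S | connect (del_adj S) x y].

Lemma class_in S x : x \notin S -> class S x \in components S.
Proof. by move=> xS; apply/imsetP; exists x; rewrite ?inE. Qed.

Lemma class_refl S x : x \notin S -> x \in class S x.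
Proof. by move=> xS; rewrite !inE xS connect0. Qed.

Lemma nontrivial_bounds C D : bounds D C -> 2 <= #|C| -> 2 <= #|~: (C :|: D)| ->
  nontrivial_cut (D :\: C).
Proof.
move=> bD C2 R2; set S := D :\: C.
apply/andP; split; first by apply: is_cut_bounds => //; [apply: ltnW C2 | apply: ltnW R2].
apply/existsP; exists [set X in components S | X \subset C].
apply/existsP; exists [set X in components S | ~~ (X \subset C)].
apply/and4P; split.
- by apply/eqP/setP => X; rewrite !inE -andb_orr orbN andbT.
- rewrite disjoints_subset; apply/subsetP => X; rewrite !inE => /andP[-> ->].
  by [].
- apply: leq_trans C2 (subset_leq_card _); apply/subsetP => x xC.
  have xS : x \notin S by rewrite !inE xC.
  apply/bigcupP; exists (class S x); last exact: class_refl.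
  rewrite inE class_in //=; apply/subsetP => y; rewrite !inE => /andP[_ xy].
  exact: connect_in bD xy xC.
apply: leq_trans R2 (subset_leq_card _); apply/subsetP => x.
rewrite in_setC in_setU negb_or => /andP[xC xD].
have xS : x \notin S by rewrite !inE negb_and xD orbT.
apply/bigcupP; exists (class S x); last exact: class_refl.
rewrite inE class_in //=; apply: contra xC => /subsetP; apply; exact: class_refl.
Qed.

Lemma is_cut_separates S : is_cut S ->
  exists f, [/\ separates f, part f None = S & forall b : bool, 0 < #|part f (Some b)|].
Proof.
move=> /existsP[x /andP[xS /existsP[y /andP[yS xy]]]].
rewrite inE in xS; rewrite inE in yS.
pose f z := if z \in S then None else Some (connect (del_adj S) x z).
exists f; split.
- move=> z t b zt; rewrite /f; case: ifPn => // zS [] <-; case: ifPn => // tS [].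
  have del : del_adj S z t by rewrite /del_adj zS tS.
  by rewrite (same_connect_r (sym_connect_sym (@del_adj_sym S)) (connect1 del)); case: (connect _ _ _).
- by apply/setP => z; rewrite inE /f; case: (z \in S).
case; apply/card_gt0P; first by exists x; rewrite inE /f (negbTE xS) connect0.
by exists y; rewrite inE /f (negbTE yS) (negbTE xy).
Qed.

(** A vertex determines its component, so membership in [cover C1] is constant along edges outside
    [S] and fails on [cover C2]. *)
Lemma nontrivial_separates S : nontrivial_cut S ->
  exists f, [/\ separates f, part f None = S & forall b : bool, 2 <= #|part f (Some b)|].
Proof.
have cs := sym_connect_sym (@del_adj_sym S).
move=> /andP[_ /existsP[C1 /existsP[C2 /and4P[/eqP CE dis c1 c2]]]].
have inC X z : X \in components S -> z \in X -> z \notin S /\ X = class S z.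
  move=> /imsetP[x xS ->]; rewrite !inE => /andP[zS xz]; split=> //.
  by apply/setP => t; rewrite !inE (same_connect cs xz).
have subC1 X : X \in C1 -> X \in components S by move=> XC; rewrite -CE inE XC.
have subC2 X : X \in C2 -> X \in components S by move=> XC; rewrite -CE inE XC orbT.
pose f z := if z \in S then None else Some (z \in cover C1).
have cov z : z \in cover C1 -> f z = Some true.
  move=> zc; rewrite /f zc; case/bigcupP: zc => X XC zX.
  by have [/negbTE -> _] := inC X z (subC1 X XC) zX.
exists f; split.
- move=> z t b zt; rewrite /f; case: ifPn => // zS [] <-; case: ifPn => // tS [].
  have del : del_adj S z t by rewrite /del_adj zS tS.
  suff -> : (z \in cover C1) = (t \in cover C1) by case: (t \in _).
  have c1zt := connect1 del; have c1tz : connect (del_adj S) t z by rewrite cs.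
  apply/bigcupP/bigcupP => -[X XC zX]; exists X => //;
    by have [_ ->] := inC X _ (subC1 X XC) zX; rewrite !inE ?zS ?tS ?c1zt ?c1tz.
- by apply/setP => z; rewrite inE /f; case: (z \in S).
case.
  apply: leq_trans c1 (subset_leq_card _); apply/subsetP => z /cov fz.
  by rewrite inE fz.
apply: leq_trans c2 (subset_leq_card _); apply/subsetP => z /bigcupP[Y YC zY].
have [zS YE] := inC Y z (subC2 Y YC) zY.
rewrite inE /f (negbTE zS); apply/eqP; congr Some; apply/negbTE/bigcupP => -[X XC zX].
have [_ XE] := inC X z (subC1 X XC) zX.
by move: dis; rewrite disjoints_subset => /subsetP/(_ X XC); rewrite inE XE -YE YC.
Qed.

Lemma separates_bounds f (b : bool) : separates f -> bounds (part f None) (part f (Some b)).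
Proof.
move=> sf x y; rewrite !inE => /eqP fx xy; have := sf x y b xy fx.
by case: (f y) => [[]|] //; case: (b).
Qed.

Lemma separates_rest f (b : bool) :
  ~: (part f (Some b) :|: part f None) = part f (Some (~~ b)).
Proof. by apply/setP => z; rewrite !inE; case: (f z) => [[]|]; case: b. Qed.

End Cuts.

Section Contract.
Variables (G : sgraph) (x y : G).
Hypothesis xy : adj x y.

(** [insub] sends both ends of the edge to [None], which is the identified vertex; so this pulls a
    labelling back along the contraction. *)
Definition lift (h : contract x y -> option bool) : G -> option bool :=
  fun z => h (insub z : contract_vertex x y).

Lemma insub_end z : z \in [set x; y] -> (insub z : contract_vertex x y) = None.
Proof. by move=> zxy; apply: insubN; rewrite negbK. Qed.

Lemma separates_lift h : separates h -> separates (lift h).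
Proof.
move=> sh z t b zt; rewrite /lift.
case: insubP => [a _ az|zxy]; case: insubP => [c _ ct|txy].
- by apply: sh; rewrite /= az ct.
- apply: sh => /=; rewrite az; move: txy; rewrite negbK !inE.
  by case/orP=> /eqP <-; rewrite zt ?orbT.
- apply: sh => /=; rewrite ct; move: zxy; rewrite negbK !inE.
  by case/orP=> /eqP <-; rewrite zt ?orbT.
by move=> ->; case: b.
Qed.

Let unlift (v : contract_vertex x y) : G := if v is Some a then val a else x.

Let unliftK : cancel unlift (insub : G -> contract_vertex x y).
Proof.
by case=> [a|] /=; [exact: valK | apply: insub_end; rewrite !inE eqxx].
Qed.

Let insub_unlift z : z != y -> unlift (insub z) = z.
Proof.
move=> zy; rewrite /unlift; case: insubP => [a _ //|].
by rewrite negbK !inE (negbTE zy) orbF => /eqP.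
Qed.

(** Both ends receive the label of the identified vertex, so exactly that class gains one vertex. *)
Lemma card_lift h (s : option bool) :
  #|part (lift h) s| = #|part h s| + (h None == s).
Proof.
have inj : injective unlift := can_inj unliftK.
have yN : y \notin unlift @: part h s.
  apply/imsetP => -[[a|] _ /= yE]; last by move: xy; rewrite yE adjxx.
  by have /negP[] : sval a \notin [set x; y] := valP a; rewrite -yE !inE eqxx orbT.
have fy : lift h y = h None by rewrite /lift insub_end // !inE eqxx orbT.
have img z : z != y -> (z \in unlift @: part h s) = (lift h z == s).
  move=> zy; apply/imsetP/idP => [[v + ->]|lz]; first by rewrite inE /lift unliftK.
  by exists (insub z); [rewrite inE | rewrite insub_unlift].
have cI : #|unlift @: part h s| = #|part h s| := card_imset _ inj.
rewrite -cI; case: (h None =P s) => hs.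
  rewrite addnC (_ : part _ _ = y |: unlift @: part h s) ?cardsU1 ?yN //.
  apply/setP => z; rewrite in_setU1 inE; case: (eqVneq z y) => [->|zy].
    by rewrite fy hs eqxx.
  by rewrite img.
rewrite addn0; apply: eq_card => z; rewrite inE; case: (eqVneq z y) => [->|zy].
  by rewrite fy (negbTE yN); apply/eqP.
by rewrite img.
Qed.

Lemma card_contract : #|contract x y| = #|G|.-1.
Proof.
rewrite card_option card_sig -(cardsC [set x; y]) cards2 adj_neq //= add1n.
by congr _.+1; apply: eq_card => z; rewrite !inE.
Qed.

End Contract.

(** The boolean form makes the existence of a contractible edge decidable and turns its failure into
    an explicit cut. *)
Definition quasi_connectedb k (G : sgraph) :=
  [&& k.-1 < #|G|, [forall S : {set G}, (#|S| < k.-1) ==> ~~ is_cut S] &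
      [forall S : {set G}, (#|S| == k.-1) ==> ~~ nontrivial_cut S]].

Lemma quasi_connectedP k (G : sgraph) :
  reflect (quasi_connected k G) (quasi_connectedb k G).
Proof.
apply: (iffP and3P) => [[c1 /forallP c2 /forallP c3]|[[c1 c2] c3]].
  split; first by split=> // S S3; apply: (implyP (c2 S)).
  by move=> S /eqP S4; apply: (implyP (c3 S)).
by split=> //; apply/forallP => S; apply/implyP; [exact: c2 | move=> /eqP; exact: c3].
Qed.

(** * A graph without contractible edge is critical *)

Section Reduction.
Variable G : sgraph.
Hypothesis hG : quasi_connected 5 G.
Hypothesis hdeg : forall x y : G, at_distance x y 1 \/ at_distance x y 2 ->
  9 <= degree x + degree y.

Lemma quasi_conn4 (C D : {set G}) : bounds D C -> 0 < #|C| -> 0 < #|~: (C :|: D)| ->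
  4 <= #|D|.
Proof.
have [[_ c4] _] := hG.
move=> bD C0 R0; rewrite leqNgt; apply/negP => D3.
have /negP := c4 (D :\: C) (leq_ltn_trans (subset_leq_card (subsetDl _ _)) D3).
by case; apply: is_cut_bounds.
Qed.

Lemma quasi_conn5 (C D : {set G}) : bounds D C -> 2 <= #|C| -> 2 <= #|~: (C :|: D)| ->
  5 <= #|D|.
Proof.
have [[_ c4] c5] := hG.
move=> bD C2 R2; rewrite leqNgt; apply/negP => D4.
have SD : #|D :\: C| <= #|D| by apply/subset_leq_card/subsetDl.
have nt := nontrivial_bounds bD C2 R2; have cut : is_cut (D :\: C) by case/andP: nt.
have [S3|S3] := ltnP #|D :\: C| 4; first by have := c4 _ S3; rewrite cut.
have S4 : #|D :\: C| = 4 by apply/eqP; rewrite eqn_leq S3 andbT; apply: leq_trans SD _.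
by have := c5 _ S4; rewrite nt.
Qed.

Lemma quasi_deg_ge4 (v : G) : 4 <= degree v.
Proof.
have [[G5 _] _] := hG; rewrite leqNgt; apply/negP => dv.
suff : 4 <= degree v by rewrite leqNgt dv.
apply: (@quasi_conn4 [set v]).
- by move=> a b; rewrite !inE => /eqP -> ->; rewrite orbT.
- by rewrite cards1.
rewrite cardsCs setCK subn_gt0; apply: leq_ltn_trans (leq_card_setU _ _) _.
by rewrite cards1 add1n; apply: leq_ltn_trans G5.
Qed.

Lemma distance1 (v w : G) : adj v w -> at_distance v w 1.
Proof.
move=> vw; split; first by exists [:: w] => //; split; rewrite /= ?vw ?inE ?adj_neq.
by case=> // -[_ _ /= E]; move: vw; rewrite E adjxx.
Qed.

Lemma distance2 (v z w : G) : adj v z -> adj z w -> v != w -> ~~ adj v w ->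
  at_distance v w 2.
Proof.
move=> vz zw vw nvw; split.
  exists [:: z; w] => //; split; rewrite /= ?vz ?zw //.
  by rewrite !inE negb_or (adj_neq vz) vw (adj_neq zw).
case=> [|t [|s p]] // [].
  by move=> _ _ /= E; rewrite E eqxx in vw.
by move=> /= /andP[vt _] _ E; rewrite -E vt in nvw.
Qed.

Lemma quasi_far (v w : G) : v != w -> degree v <= 4 -> degree w <= 4 ->
  ~~ adj v w /\ (forall z, adj v z -> ~~ adj w z).
Proof.
move=> vw dv dw; have le8 : degree v + degree w <= 8 by exact: (leq_add dv dw).
have far12 : at_distance v w 1 \/ at_distance v w 2 -> False.
  by move=> /hdeg; rewrite leqNgt ltnS le8.
have nvw : ~~ adj v w by apply/negP => /distance1 H; apply: far12; left.
split=> // z vz; apply/negP; rewrite adjC => zw; apply: far12; right.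
exact: distance2 vz zw vw nvw.
Qed.

(** A cut of the contraction lifts to a cut of [G] with at most one vertex more. If it had at most 3
    vertices, the lifted cut has exactly 4 and contains both ends; one of its sides is then a single
    vertex of degree 4 adjacent to both ends, which is excluded. A nontrivial cut of 4 vertices
    cannot lift to 4 vertices, so it gains one, and both ends lie in the resulting 5-cut. *)
Lemma quasi_edge_cut (x y : G) : adj x y ->
  (forall z, adj x z -> adj y z -> 5 <= degree z) -> ~ quasi_connected 5 (contract x y) ->
  exists f, [/\ cut5 f, f x = None & f y = None].
Proof.
move=> xy common /quasi_connectedP; rewrite /quasi_connectedb !negb_and /=.
have ends h : h None = None -> @lift G x y h x = None /\ @lift G x y h y = None.
  by move=> hN; rewrite /lift !insub_end // !inE eqxx ?orbT.
(* By the degree sum at distance one, an end of the edge has degree at least 5, so [G] has at least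
   6 vertices and the contraction at least 5. *)
have G6 : 4 < #|contract x y|.
  rewrite card_contract //.
  have big (v : G) : 5 <= degree v -> 4 < #|G|.-1.
    move=> dv; have : #|v |: [set w | adj v w]| <= #|G| by exact: max_card.
    by rewrite cardsU1 inE adjxx /= add1n -/(degree v); case: #|G| => // n; exact: leq_trans dv.
  have [dx|dx] := leqP 5 (degree x); first exact: big dx.
  have [dy|dy] := leqP 5 (degree y); first exact: big dy.
  have := hdeg (or_introl (distance1 xy)); move: dx dy.
  by move: (degree x) (degree y) => i j; clear; lia.
rewrite G6 /= => /orP[]; rewrite negb_forall => /existsP[S];
  rewrite negb_imply negbK => /andP[].
  move=> S3 /is_cut_separates[h [sh hS h0]]; exfalso.
  have sf := separates_lift sh; set f := lift h in sf.
  have fp b : 0 < #|part f (Some b)| by rewrite card_lift //; apply: leq_trans (leq_addr _ _).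
  have f4 : 4 <= #|part f None|.
    by apply: (quasi_conn4 (separates_bounds (b := true) sf) (fp true)); rewrite separates_rest.
  have := f4; rewrite card_lift // hS; case hN: (h None == None); last first.
    by rewrite addn0 leqNgt S3.
  rewrite addn1 ltnS => S3'.
  have c4 : #|part f None| = 4.
    by rewrite card_lift // hS hN addn1; congr _.+1; apply/eqP; rewrite eqn_leq S3' andbT.
  have [fx fy] := ends h (eqP hN).
  have [b fb] : exists b, #|part f (Some b)| = 1.
    have [t2|t2] := leqP 2 #|part f (Some true)|; last first.
      by exists true; apply/eqP; rewrite eqn_leq fp andbT.
    exists false; apply/eqP; rewrite eqn_leq fp andbT leqNgt; apply/negP => f2.
    have : 5 <= #|part f None|.
      by apply: (quasi_conn5 (separates_bounds (b := true) sf) t2); rewrite separates_rest.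
    by rewrite c4.
  have /cards1P[v fv] : #|part f (Some b)| == 1 by rewrite fb.
  have Nv : [set w | adj v w] \subset part f None.
    apply/subsetP => w; rewrite inE => vw.
    have : w \in part f (Some b) :|: part f None.
      by apply: (separates_bounds sf _ vw); rewrite fv inE.
    by rewrite fv in_setU inE => /orP[/eqP wv|//]; move: vw; rewrite wv adjxx.
  have NE : [set w | adj v w] = part f None.
    by apply/eqP; rewrite eqEcard Nv c4 quasi_deg_ge4.
  have vx : adj x v by rewrite adjC; have /setP/(_ x) := NE; rewrite !inE /f fx => ->.
  have vy : adj y v by rewrite adjC; have /setP/(_ y) := NE; rewrite !inE /f fy => ->.
  by have := common v vx vy; rewrite /degree NE c4.
move=> /eqP S4 /nontrivial_separates[h [sh hS h2]].
have sf := separates_lift sh; set f := lift h in sf.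
have fp (b : bool) : 2 <= #|part f (Some b)| by rewrite card_lift //; apply: leq_trans (leq_addr _ _).
have : 5 <= #|part f None|.
  by apply: (quasi_conn5 (separates_bounds (b := true) sf) (fp true)); rewrite separates_rest.
have := card_lift xy h None; rewrite -/f hS S4; case hN: (h None == None); last by move=> ->.
move=> f5 _; have [fx fy] := ends h (eqP hN).
by exists f; split=> //; split.
Qed.

End Reduction.

Theorem theorem2 (G : sgraph)
  (hG : quasi_connected 5 G)
  (hdeg : forall x y : G, at_distance x y 1 \/ at_distance x y 2 ->
            9 <= degree x + degree y) :
  exists x y : G, quasi_contractible 5 x y.
Proof.
case: (boolP [exists x : G, [exists y : G, adj x y && quasi_connectedb 5 (contract x y)]]).
  by case/existsP=> x /existsP[y /andP[xy /quasi_connectedP q]]; exists x, y.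
rewrite negb_exists => /forallP none; exfalso.
have [[G5 _] _] := hG; have /card_gt0P[v _] : 0 < #|G| by exact: leq_ltn_trans G5.
apply: (not_critical v); split.
- exact: quasi_conn4.
- exact: quasi_conn5.
- exact: quasi_deg_ge4.
- exact: quasi_far.
move=> x y xy common; apply: quasi_edge_cut => // /quasi_connectedP q.
by have := none x; rewrite negb_exists => /forallP/(_ y); rewrite xy q.
Qed.
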